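(* Suppose that for every $\epsilon>0$ there is a $w_\epsilon$ such that every finite poset $P$ of width greater than $w_\epsilon$ satisfies $\delta(P)>1/2-\epsilon$. Then for every $\epsilon>0$ there is a $p_\epsilon$ such that every finite poset $P$ with $\pi(P)>p_\epsilon$ satisfies $\delta(P)>1/2-\epsilon$.
   Context: All posets are finite. The width of $P$ is the maximum size of an antichain. For a uniformly random linear extension $\prec$ of $P$ and distinct $x,y\in P$, $\delta_{xy}=\min\{\mathbb{P}(x\prec y),\mathbb{P}(y\prec x)\}$ and $\delta(P)=\max\delta_{xy}$ over distinct $x,y\in P$. For $x\in P$, $\pi(x)$ is the number of elements of $P$ incomparable to $x$, and $\pi(P)=\max_{x\in P}\pi(x)$. *)

(* Defs.v *)
From HB Require Import structures.
From mathcomp Require Import all_boot all_order all_algebra.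
From mathcomp Require Import reals.

Set Implicit Arguments.
Unset Strict Implicit.
Unset Printing Implicit Defensive.

Import Order.TTheory GRing.Theory Num.Theory.

Local Open Scope ring_scope.

Section Posets.
Context {d : Order.disp_t} (P : finPOrderType d).

Definition antichain (A : {set P}) : bool :=
  [forall x in A, forall y in A, (x != y) ==> (x >< y)%O].

Definition width : nat := \max_(A : {set P} | antichain A) #|A|.

Definition pi_elt (x : P) : nat := #|[set y : P | (y >< x)%O]|.

Definition pi_poset : nat := \max_(x : P) pi_elt x.

(* A set [L] of pairs encodes the strict relation "x precedes y" as
   [(x, y) \in L]. *)
Definition strict_linear_order (L : {set P * P}) : bool :=
  [&& [forall x, (x, x) \notin L],
      [forall x, forall y, forall z,
         ((x, y) \in L) && ((y, z) \in L) ==> ((x, z) \in L)]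
    & [forall x, forall y, (x != y) ==> ((x, y) \in L) || ((y, x) \in L)]].

Definition linear_extension (L : {set P * P}) : bool :=
  strict_linear_order L &&
  [forall x : P, forall y : P, (x < y)%O ==> ((x, y) \in L)].

Definition linear_extensions : {set {set P * P}} :=
  [set L | linear_extension L].

Variable R : realType.

(* Probability that [x] precedes [y] in a uniformly random linear extension. *)
Definition prec_prob (x y : P) : R :=
  #|[set L in linear_extensions | (x, y) \in L]|%:R / #|linear_extensions|%:R.

Definition delta_pair (x y : P) : R := Num.min (prec_prob x y) (prec_prob y x).

(* The values are nonnegative, so the default [0] only matters when [P] has no
   two distinct elements, in which case the maximum is over an empty family. *)
Definition delta : R :=
  \big[Num.max/0]_(p : P * P | p.1 != p.2) delta_pair p.1 p.2.

End Posets.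

(* Main.v *)
(** A poset of large width is handled by the hypothesis, so let the width be at
    most [w] and suppose that no pair is [eps]-balanced. For each [y] let [dn y]
    be the set of elements that precede [y] with probability above 1/2.

    By correlation, with probability at least [c(eps, w) > 0] the element [y]
    comes right after [dn y], i.e. at position [#|dn y|]. The four functions
    theorem, applied to order-preserving maps one of which is shifted, shows that
    an element close to [y] with probability bounded below is rarely far above
    [y]; as there are no balanced pairs, this yields a constant [k] such that
    with probability close to 1 all of [dn y] comes before position [g y + k] and
    everything else after position [g y - k].

    Let [x] be incomparable to every element of a chain [c_0 < c_1 < ...]
    contained in [dn x], and let [X] be the set of elements below or equal to
    [x]. Cut the chain into blocks of bounded length with endpoints [y_i]; let
    [l_i] and [a_i] count the elements of [dn y_{i+1} \ dn y_i], respectively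
    those in [X]. Long blocks have [a_i] large: otherwise, for a long
    segment [c_i < ... < c_j] of the chain, some [z] in [X] has this segment in
    [dn z] but all its predecessors in [dn c_i], and then [z] could be lowered by
    many different amounts, each with probability bounded below.
    Moving one element of [X] from above [y_i] to below it raises the position of
    [y_i] by one, and counting these moves shows that, unless [l_i / a_i] exceeds
    [l_{i-1} / a_{i-1}] by a constant factor, [y_i] would take too many
    consecutive positions with probability bounded below. Hence [l_i / a_i] grows
    geometrically, whereas [l_i <= 3 pi(P) + 1]: the chain has length
    [O(log pi(P))]. But the [pi(P)] elements incomparable to a suitable [x]
    contain a chain of length at least [pi(P) / (2 w)] in [dn x] or, dually, in
    its complement. *)

Require Import Defs.
From HB Require Import structures.
From mathcomp Require Import all_boot all_order all_algebra.
From mathcomp Require Import reals.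
From mathcomp Require Import zify ring lra.

Import Order.TTheory GRing.Theory Num.Theory.

Set Implicit Arguments.
Unset Strict Implicit.
Unset Printing Implicit Defensive.

(** * A four functions theorem and the shifted lattice of order-preserving maps *)

(** Expanding [(P - u) * (P - v) >= 0] gives [P * (u + v) <= P * P + u * v]; it remains to bound
    [u * v] and cancel [P]. *)
Lemma four_number (u v P Q : nat) :
  u <= P -> v <= P -> u * v <= P * Q -> u + v <= P + Q.
Proof.
move=> uP vP uvPQ; case: (posnP P) => [P0|P0]; first by lia.
suff: P * (u + v) <= P * (P + Q) by rewrite leq_pmul2l.
by nia.
Qed.

(** The one-coordinate case. The double sums split into the diagonal, bounded termwise, and the
    pairs [i < j], where [four_number] applies with [P = c j * d i] and [Q = c i * d j]. *)
Lemma four_functions_chain m (a b c d : 'I_m -> nat) :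
  (forall i j : 'I_m, a i * b j <= c (if i < j then j else i) * d (if i < j then i else j)) ->
  (\sum_(i < m) a i) * (\sum_(i < m) b i) <= (\sum_(i < m) c i) * (\sum_(i < m) d i).
Proof.
move=> H.
have tri (F : 'I_m -> 'I_m -> nat) : \sum_(i < m) \sum_(j < m) F i j =
    \sum_(i < m) F i i + \sum_(i < m) \sum_(j < m | i < j) (F i j + F j i).
  have -> : \sum_(i < m) \sum_(j < m) F i j =
     \sum_(i < m) (F i i + \sum_(j < m | i < j) F i j + \sum_(j < m | j < i) F i j).
    apply: eq_bigr => i _.
    rewrite (bigD1 i) //= -addnA; congr (_ + _).
    rewrite (bigID (fun j : 'I_m => i < j)) /=; congr (_ + _); apply: eq_bigl => j.
      by rewrite -(inj_eq val_inj) neq_ltn; case: ltngtP.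
    by rewrite -(inj_eq val_inj) neq_ltn; case: ltngtP.
  rewrite !big_split /= -addnA; congr (_ + _).
  have -> : \sum_(i < m) \sum_(j < m | i < j) (F i j + F j i) =
     \sum_(i < m) (\sum_(j < m | i < j) F i j + \sum_(j < m | i < j) F j i).
    by apply: eq_bigr => i _; rewrite big_split.
  rewrite big_split /=; congr (_ + _).
  by rewrite (exchange_big_dep predT).
rewrite !big_distrlr /= !tri; apply: leq_add.
  by apply: leq_sum => i _; have := H i i; rewrite ltnn.
apply: leq_sum => i _; apply: leq_sum => j ij.
have ji : (j < i) = false by apply: ltn_geF; apply: ltnW.
have := H i j; have := H j i; have := H i i; have := H j j.
rewrite !ltnn ij ji => Hjj Hii Hji Hij.
rewrite [X in _ <= X]addnC; apply: four_number => //.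
by have := leq_mul Hii Hjj; lia.
Qed.

Section FourFunctions.
Variables (T : finType) (m : nat).
Implicit Types (f g : {ffun T -> 'I_m}) (a b c d : {ffun T -> 'I_m} -> nat).

Definition fjoin f g : {ffun T -> 'I_m} := [ffun x => if f x < g x then g x else f x].
Definition fmeet f g : {ffun T -> 'I_m} := [ffun x => if f x < g x then f x else g x].

Definition four_cond a b c d := forall f g, a f * b g <= c (fjoin f g) * d (fmeet f g).

Definition upd f x i : {ffun T -> 'I_m} := [ffun y => if y == x then i else f y].

Definition sum_at x a f := \sum_i a (upd f x i).

(** Summing out one coordinate is an instance of the chain case, so the condition survives; doing it
    for every coordinate leaves the total sums. *)
Lemma four_cond_sum_at x a b c d : four_cond a b c d ->
  four_cond (sum_at x a) (sum_at x b) (sum_at x c) (sum_at x d).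
Proof.
move=> H f g; apply: four_functions_chain => i j.
have := H (upd f x i) (upd g x j).
have -> : fjoin (upd f x i) (upd g x j) = upd (fjoin f g) x (if i < j then j else i).
  by apply/ffunP => y; rewrite !ffunE; case: eqP.
suff -> : fmeet (upd f x i) (upd g x j) = upd (fmeet f g) x (if i < j then i else j) by [].
by apply/ffunP => y; rewrite !ffunE; case: eqP.
Qed.

Lemma sum_at_foldr (s : seq T) a f : uniq s ->
  foldr sum_at a s f = \sum_(g : {ffun T -> 'I_m} | [forall y, (y \notin s) ==> (g y == f y)]) a g.
Proof.
elim: s f => [|x s IH] f /=.
  move=> _; rewrite (big_pred1 f) // => g; apply/forallP/eqP => [H|-> y]; last by rewrite eqxx.
  by apply/ffunP => y; apply/eqP; have := H y.
case/andP => xs us; rewrite /sum_at; under eq_bigr do rewrite IH //.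
rewrite (partition_big (fun g : {ffun T -> 'I_m} => g x) predT) //=.
apply: eq_bigr => i _; apply: eq_bigl => g; apply/forallP/andP => [H|[/forallP H /eqP gx] y].
  split; last by have := H x; rewrite xs ffunE eqxx.
  apply/forallP => y; apply/implyP; rewrite in_cons negb_or => /andP[yx ys].
  by have := H y; rewrite ys ffunE (negPf yx).
rewrite ffunE; case: (y =P x) => [->|/eqP yx]; first by rewrite gx eqxx implybT.
by have := H y; rewrite in_cons (negPf yx).
Qed.

Lemma four_functions a b c d : four_cond a b c d ->
  (\sum_f a f) * (\sum_f b f) <= (\sum_f c f) * (\sum_f d f).
Proof.
move=> H.
have Hs s : four_cond (foldr sum_at a s) (foldr sum_at b s) (foldr sum_at c s) (foldr sum_at d s).
  by elim: s => //= x s; apply: four_cond_sum_at.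
case: (pickP {: {ffun T -> 'I_m}}) => [f0 _|no]; last first.
  by rewrite [X in X * _]big1 // => f; have := no f.
have all0 e f : foldr sum_at e (enum T) f = \sum_(g : {ffun T -> 'I_m}) e g.
  rewrite sum_at_foldr ?enum_uniq //; apply: eq_bigl => g; apply/forallP => y.
  by rewrite mem_enum.
by have := Hs (enum T) f0 f0; rewrite !all0.
Qed.

Lemma card_join_meet (A B C D : {set {ffun T -> 'I_m}}) :
  (forall f g, f \in A -> g \in B -> fjoin f g \in C /\ fmeet f g \in D) ->
  #|A| * #|B| <= #|C| * #|D|.
Proof.
move=> H.
have E (X : {set {ffun T -> 'I_m}}) : #|X| = \sum_f (f \in X).
  by rewrite -sum1_card big_mkcond; apply: eq_bigr => f _; case: (f \in X).
rewrite !E; apply: four_functions => f g.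
case fA : (f \in A) => //; case gB : (g \in B) => //.
by have [-> ->] := H f g fA gB.
Qed.

End FourFunctions.

Section ShiftedLattice.
Variables (T : finType) (N : nat).
Implicit Types (f g : {ffun T -> 'I_N}) (y e : T).

Definition shift_join y s f g e : nat :=
  minn (f y) (g y + s) + maxn (f e + g y + s) (g e + f y) - (f y + g y + s).
Definition shift_meet y s f g e : nat :=
  maxn (f y - s) (g y) + minn (f e + g y + s) (g e + f y) - (f y + g y).

(** Splitting on [f y <= g y + s] shows that the value lies between 0 and [maxn (f e) (g e)], so the
    subtraction in [shift_join] never truncates; the same holds for [shift_meet]. *)
Lemma shift_join_bound y s f g e : shift_join y s f g e < N.
Proof.
have := ltn_ord (f y); have := ltn_ord (g y); have := ltn_ord (f e); have := ltn_ord (g e).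
by rewrite /shift_join; lia.
Qed.

Lemma shift_meet_bound y s f g e : shift_meet y s f g e < N.
Proof.
have := ltn_ord (f y); have := ltn_ord (g y); have := ltn_ord (f e); have := ltn_ord (g e).
by rewrite /shift_meet; lia.
Qed.

Definition fshift_join y s f g : {ffun T -> 'I_N} :=
  [ffun e => Ordinal (shift_join_bound y s f g e)].
Definition fshift_meet y s f g : {ffun T -> 'I_N} :=
  [ffun e => Ordinal (shift_meet_bound y s f g e)].

Lemma fshift_joinE y s f g e : fshift_join y s f g e = shift_join y s f g e :> nat.
Proof. by rewrite ffunE. Qed.
Lemma fshift_meetE y s f g e : fshift_meet y s f g e = shift_meet y s f g e :> nat.
Proof. by rewrite ffunE. Qed.

(* In the coordinates [- f y] and [f e - f y] (e <> y), offset to be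
   nonnegative, [fshift_join] and [fshift_meet] are the coordinatewise maximum
   of [f] and [g - s] and the coordinatewise minimum of [f + s] and [g]. *)
Let coord y s f e : nat := N + s + (if e == y then 0 else f e) - f y.

Lemma coord_bound y s k f e : coord y s f e - k < N + s + N.
Proof.
have := ltn_ord (f y); have := ltn_ord (f e).
by rewrite /coord; case: eqP => _; lia.
Qed.

Let fcoord y s k f : {ffun T -> 'I_(N + s + N)} :=
  [ffun e => Ordinal (coord_bound y s k f e)].

Lemma fcoord_inj y s k : k <= s -> injective (fcoord y s k).
Proof.
move=> ks f g /ffunP E; have Ev e : coord y s f e - k = coord y s g e - k.
  by have := E e; rewrite !ffunE => -[].
have Ey : f y = g y :> nat.
  have := Ev y; rewrite /coord eqxx; have := ltn_ord (f y); have := ltn_ord (g y); lia.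
apply/ffunP => e; apply: val_inj => /=; case: (e =P y) => [->|/eqP ey] //.
have := Ev e; rewrite /coord (negPf ey) Ey.
have := ltn_ord (f y); have := ltn_ord (g y); lia.
Qed.

(** Encode [A] and [C] with offset 0, [B] and [D] with offset [s]. The encodings are injective and
    turn the shifted operations into pointwise maximum and minimum, so [card_join_meet] applies. *)
Lemma card_shift_join_meet y s (A B C D : {set {ffun T -> 'I_N}}) :
  (forall f g, f \in A -> g \in B ->
     fshift_join y s f g \in C /\ fshift_meet y s f g \in D) ->
  #|A| * #|B| <= #|C| * #|D|.
Proof.
move=> H.
rewrite -(card_imset A (@fcoord_inj y s 0 (leq0n s))).
rewrite -(card_imset C (@fcoord_inj y s 0 (leq0n s))).
rewrite -(card_imset B (@fcoord_inj y s s (leqnn s))).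
rewrite -(card_imset D (@fcoord_inj y s s (leqnn s))).
apply: card_join_meet => _ _ /imsetP[f fA ->] /imsetP[g gB ->].
have [hC kD] := H f g fA gB; split; apply/imsetP.
  exists (fshift_join y s f g) => //; apply/ffunP => e; rewrite !ffunE.
  apply: val_inj; rewrite [RHS]/= /coord !fshift_joinE (fun_if val) /= /coord /shift_join.
  have := ltn_ord (f y); have := ltn_ord (g y); have := ltn_ord (f e); have := ltn_ord (g e).
  by case: eqP => [->|_]; case: ifP; lia.
exists (fshift_meet y s f g) => //; apply/ffunP => e; rewrite !ffunE.
apply: val_inj; rewrite [RHS]/= /coord !fshift_meetE (fun_if val) /= /coord /shift_meet.
have := ltn_ord (f y); have := ltn_ord (g y); have := ltn_ord (f e); have := ltn_ord (g e).
by case: eqP => [->|_]; case: ifP; lia.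
Qed.

End ShiftedLattice.

(** * Order-preserving maps into a chain and the linear extensions they induce *)

Section OrderPreserving.
Variable T : finType.
Implicit Types (r : rel T) (x y z : T).

Definition opm N r : {set {ffun T -> 'I_N}} :=
  [set f : {ffun T -> 'I_N} | [forall x, forall y, r x y ==> (f x < f y)]].

(* A linear extension is encoded by the position of each element. *)
Definition le_set r : {set {ffun T -> 'I_#|T|}} := [set g in opm #|T| r | injectiveb g].

Lemma opmP N r (f : {ffun T -> 'I_N}) :
  reflect (forall x y, r x y -> f x < f y) (f \in opm N r).
Proof.
rewrite inE; apply: (iffP forallP) => [H x y rxy|H x].
  by have /forallP/(_ y)/implyP := H x; apply.
by apply/forallP => y; apply/implyP; apply: H.
Qed.

Lemma le_setP r (g : {ffun T -> 'I_#|T|}) :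
  reflect ((forall x y, r x y -> g x < g y) /\ injective g) (g \in le_set r).
Proof.
rewrite inE; apply: (iffP andP) => [[/opmP ? /injectiveP]|[? ?]] //.
by split; [apply/opmP|apply/injectiveP].
Qed.

Lemma rank_bound N (f : {ffun T -> 'I_N}) x : #|[set y | f y < f x]| < #|T|.
Proof.
rewrite -cardsT; apply: proper_card; apply/properP; split; first exact: subsetT.
by exists x; rewrite ?inE ?ltnn.
Qed.

Definition rank N (f : {ffun T -> 'I_N}) : {ffun T -> 'I_#|T|} :=
  [ffun x => Ordinal (rank_bound f x)].

Lemma rankE N (f : {ffun T -> 'I_N}) x : rank f x = #|[set y | f y < f x]| :> nat.
Proof. by rewrite ffunE. Qed.

Lemma rank_mono N (f : {ffun T -> 'I_N}) x y : (rank f x < rank f y) = (f x < f y).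
Proof.
rewrite !rankE; apply/idP/idP => [|fxy].
  apply: contraLR; rewrite -!leqNgt => fyx; apply: subset_leq_card; apply/subsetP => z.
  by rewrite !inE => /leq_trans; apply.
apply: proper_card; apply/properP; split.
  by apply/subsetP => z; rewrite !inE => /ltn_trans; apply.
by exists x; rewrite !inE ?ltnn.
Qed.

Lemma rank_inj N (f : {ffun T -> 'I_N}) : injective f -> injective (rank f).
Proof.
move=> fi x y E; apply: fi; apply: val_inj; apply/eqP.
by rewrite eqn_leq leqNgt -rank_mono E ltnn leqNgt -rank_mono E ltnn.
Qed.

End OrderPreserving.

Section Counting.
Variable T : finType.
Implicit Types (r : rel T) (x y z : T).
Let n := #|T|.

Definition rank_fiber N (g : {ffun T -> 'I_n}) : {set {ffun T -> 'I_N}} :=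
  [set f : {ffun T -> 'I_N} | injectiveb f & rank f == g].

Lemma mem_imset_rank N (f : {ffun T -> 'I_N}) x : injective f ->
  rank f x = #|[set q in f @: T | q < f x]| :> nat.
Proof.
move=> fi; rewrite rankE -(card_imset _ fi); apply: eq_card => q; rewrite !inE.
apply/imsetP/andP => [[z]|[/imsetP[z _ ->] zx]]; last by exists z; rewrite ?inE.
by rewrite inE => zx ->; split=> //; apply: imset_f.
Qed.

Lemma card_lt_inj N (A : {set 'I_N}) p q : p \in A -> q \in A ->
  #|[set z in A | z < p]| = #|[set z in A | z < q]| -> p = q.
Proof.
have lt p' q' : p' \in A -> (p' < q')%N -> #|[set z in A | z < p']| < #|[set z in A | z < q']|.
  move=> pA pq; apply: proper_card; apply/properP; split.
    by apply/subsetP => z; rewrite !inE => /andP[-> /=] /ltn_trans; apply.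
  by exists p'; rewrite !inE ?ltnn ?pA.
move=> pA qA E; apply: val_inj; case: (ltngtP p q) => // [pq|qp].
  by have := lt _ _ pA pq; rewrite E ltnn.
by have := lt _ _ qA qp; rewrite E ltnn.
Qed.

(** The value at [x] is the element of the image that has exactly [g x] smaller ones. *)
Lemma image_fiber_inj N g : {in rank_fiber N g &, injective (fun f : {ffun T -> 'I_N} => f @: T)}.
Proof.
move=> f1 f2; rewrite !inE => /andP[/injectiveP i1 /eqP r1] /andP[/injectiveP i2 /eqP r2] E.
apply/ffunP => x; apply: (@card_lt_inj _ (f1 @: T)).
- exact: imset_f.
- by rewrite E; apply: imset_f.
by rewrite -(mem_imset_rank x i1) r1 -r2 (mem_imset_rank x i2) E.
Qed.

Lemma card_rank_fiber_le N g : #|rank_fiber N g| <= 'C(N, n).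
Proof.
have -> : 'C(N, n) = #|[set A : {set 'I_N} | #|A| == n]| by rewrite card_draws card_ord.
rewrite -(card_in_imset (@image_fiber_inj N g)); apply: subset_leq_card.
apply/subsetP => A /imsetP[f]; rewrite !inE => /andP[/injectiveP fi _] ->.
by rewrite card_imset // cardsT.
Qed.

Lemma card_injective_ffun N : #|[set f : {ffun T -> 'I_N} | injectiveb f]| = N ^_ n.
Proof. by rewrite card_inj_ffuns card_ord. Qed.

(** The [n!] fibers over injective [g] together contain all [N ^_ n = 'C(N, n) * n!] injective maps,
    and none exceeds ['C(N, n)]; so every bound is attained. *)
Lemma card_rank_fiber N (g : {ffun T -> 'I_n}) : injective g -> #|rank_fiber N g| = 'C(N, n).
Proof.
move=> gi.
pose I := [set g : {ffun T -> 'I_n} | injectiveb g].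
have tot : \sum_(h in I) #|rank_fiber N h| = \sum_(h in I) 'C(N, n).
  rewrite sum_nat_const card_injective_ffun ffactnn mulnC bin_ffact -card_injective_ffun.
  rewrite -[RHS]sum1_card (partition_big (@rank T N) (mem I)) /=.
    apply: eq_bigr => h _; rewrite -[LHS]sum1_card; apply: eq_bigl => f.
    by rewrite !inE.
  by move=> f; rewrite !inE => /injectiveP fi; apply/injectiveP; apply: rank_inj.
have := leqif_sum (fun h (_ : h \in I) => leqif_eq (card_rank_fiber_le N h)).
move=> [_]; rewrite tot eqxx => /esym /forallP /(_ g) /implyP.
by rewrite inE => H; apply/eqP/H; apply/injectiveP.
Qed.

Definition inj_opm N r := [set f in opm N r | injectiveb f].

Lemma inj_opm_rank N r (f : {ffun T -> 'I_N}) : injective f ->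
  (f \in opm N r) = (rank f \in le_set r).
Proof.
move=> fi; apply/opmP/le_setP => [H|[H _] x y /H]; last by rewrite rank_mono.
by split; [move=> x y /H; rewrite rank_mono | apply: rank_inj].
Qed.

Lemma card_inj_opm_sum N r (Q : pred {ffun T -> 'I_N}) :
  #|[set f in inj_opm N r | Q f]| = \sum_(g in le_set r) #|[set f in rank_fiber N g | Q f]|.
Proof.
rewrite -[LHS]sum1_card (partition_big (@rank T N) (mem (le_set r))) /=.
  apply: eq_bigr => h hl; rewrite -[RHS]sum1_card; apply: eq_bigl => f.
  rewrite !inE; case E : (injectiveb f); rewrite ?andbF //= andbT.
  case: eqP => [rf|]; rewrite ?andbF // andbT.
  have /injectiveP fi := E; have := inj_opm_rank r fi.
  by rewrite inE rf hl => ->.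
move=> f; rewrite !inE -!andbA => /and3P[fo /injectiveP fi _].
by have := inj_opm_rank r fi; rewrite !inE fo => <-.
Qed.

Lemma card_inj_opm N r : #|inj_opm N r| = #|le_set r| * 'C(N, n).
Proof.
have -> : inj_opm N r = [set f in inj_opm N r | predT f] by apply/setP => f; rewrite inE andbT.
rewrite card_inj_opm_sum -sum_nat_const; apply: eq_bigr => g /le_setP[_ gi].
by rewrite -(card_rank_fiber N gi); apply: eq_card => f; rewrite inE andbT.
Qed.

Definition noninj N := N ^ n - N ^_ n.

Lemma card_opm_le N r : #|opm N r| <= #|le_set r| * 'C(N, n) + noninj N.
Proof.
rewrite -card_inj_opm -(cardsID [set f : {ffun T -> 'I_N} | injectiveb f]); apply: leq_add.
  by apply: subset_leq_card; apply/subsetP => f; rewrite !inE.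
rewrite /noninj -card_injective_ffun.
have -> : N ^ n = #|[set: {ffun T -> 'I_N}]| by rewrite cardsT card_ffun card_ord.
rewrite -(cardsID [set f : {ffun T -> 'I_N} | injectiveb f] setT) setTI addKn.
by apply: subset_leq_card; apply/subsetP => f; rewrite !inE andbT => /andP[].
Qed.

Lemma inj_opm_sub N r : #|inj_opm N r| <= #|opm N r|.
Proof. by apply: subset_leq_card; apply/subsetP => f; rewrite !inE => /andP[]. Qed.

End Counting.

Lemma ffact_leq_expn N n : N ^_ n <= N ^ n.
Proof. by elim: n => // n IH; rewrite ffactnSr expnSr; apply: leq_mul => //; lia. Qed.

Lemma expn_leq_ffact_add N n : N ^ n.+1 <= N ^_ n.+1 + n.+1 * n.+1 * N ^ n.
Proof.
elim: n => [|n IH]; first by rewrite ffactn1 expn1; lia.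
rewrite ffactnSr expnSr.
have /leq_trans -> // : N ^ n.+1 * N <= (N ^_ n.+1 + n.+1 * n.+1 * N ^ n) * N.
  by rewrite leq_mul2r IH orbT.
have h1 : N ^_ n.+1 * N <= N ^_ n.+1 * (N - n.+1) + N ^_ n.+1 * n.+1.
  by rewrite -mulnDr leq_mul2l; lia.
have h2 := leq_mul (ffact_leq_expn N n.+1) (leqnn n.+1).
have -> : (N ^_ n.+1 + n.+1 * n.+1 * N ^ n) * N = N ^_ n.+1 * N + n.+1 * n.+1 * N ^ n.+1.
  by rewrite mulnDl -mulnA -expnSr.
by move: (N ^ n.+1) (N ^_ n.+1 * N) h1 h2 => a b; nia.
Qed.

(** The number of non-injective maps is of order at most [N ^ n.-1], whereas ['C(N, n)] is of order
    [N ^ n]. *)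
Lemma noninj_small n M :
  exists2 N0, n < N0 & forall N, N0 <= N -> M * (N ^ n - N ^_ n) <= 'C(N, n).
Proof.
exists ((M * n`! + 1) * (n * n) + n.+1) => [|N NN0]; first by lia.
case: n => [|n] in NN0 *; first by rewrite expn0 ffactn0 subnn muln0.
rewrite -(@leq_pmul2r n.+1`!) ?fact_gt0 // bin_ffact.
have := expn_leq_ffact_add N n; have := ffact_leq_expn N n.+1.
have : (M * n.+1`! + 1) * (n.+1 * n.+1) * N ^ n <= N ^ n.+1.
  by rewrite expnS leq_mul2r; apply/orP; right; lia.
move: (N ^ n.+1) (N ^_ n.+1) (N ^ n) (n.+1`!) (n.+1 * n.+1) => a b c d e h1 h2 h3.
have h4 : a - b <= e * c by lia.
have h5 : (M * d + 1) * (a - b) <= (M * d + 1) * (e * c) by rewrite leq_mul2l h4 orbT.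
by move: h1 h5; rewrite -mulnA; set k := M * d; set X := a - b => h1 h5; rewrite mulnAC -/k; lia.
Qed.

Section ShiftLt.
Variables (T : finType) (N : nat) (y : T) (s : nat) (f g : {ffun T -> 'I_N}).
Implicit Types a b : T.

Lemma shift_join_lt a b : f a < f b -> g a < g b -> fshift_join y s f g a < fshift_join y s f g b.
Proof. by rewrite !fshift_joinE /shift_join; lia. Qed.

Lemma shift_meet_lt a b : f a < f b -> g a < g b -> fshift_meet y s f g a < fshift_meet y s f g b.
Proof. by rewrite !fshift_meetE /shift_meet; lia. Qed.
End ShiftLt.

Lemma join_lt_center (T : finType) N (y : T) (f g : {ffun T -> 'I_N}) b :
  (f y < f b) || (g y < g b) -> fshift_join y 0 f g y < fshift_join y 0 f g b.
Proof. by rewrite !fshift_joinE /shift_join; lia. Qed.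

Lemma meet_lt_center (T : finType) N (y : T) (f g : {ffun T -> 'I_N}) a :
  (f a < f y) || (g a < g y) -> fshift_meet y 0 f g a < fshift_meet y 0 f g y.
Proof. by rewrite !fshift_meetE /shift_meet; lia. Qed.

(** * Correlation of the events that fix the sides of one element *)

Section Correlation.
Variables (T : finType) (r : rel T) (y : T).
Implicit Types (D U : {set T}).

(** Not closed under transitivity: [opm] and [le_set] only ask that the listed pairs be
    respected. *)
Definition pinned D U : rel T := fun a b =>
  [|| r a b, (a \in D) && (b == y) | (a == y) && (b \in U)].

Lemma opm_pinnedP N D U (f : {ffun T -> 'I_N}) :
  reflect [/\ forall a b, r a b -> f a < f b,
              forall a, a \in D -> f a < f y & forall b, b \in U -> f y < f b]
          (f \in opm N (pinned D U)).
Proof.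
apply: (iffP (opmP _ _)) => [H|[H1 H2 H3] a b].
  split=> [a b rab|a aD|b bU]; apply: H; rewrite /pinned.
  - by rewrite rab.
  - by rewrite aD eqxx orbT.
  by rewrite bU eqxx !orbT.
by case/or3P => [/H1|/andP[/H2 ? /eqP ->]|/andP[/eqP -> /H3]].
Qed.

(** With shift 0 the join takes the larger and the meet the smaller of the differences [f e - f y]
    and [g e - g y]. Hence an element is after [y] in the join as soon as it is so in one of the
    maps, and before [y] in the meet as soon as it is so in one. *)
Lemma card_opm_pinned N D1 U1 D2 U2 :
  #|opm N (pinned D1 U1)| * #|opm N (pinned D2 U2)| <=
  #|opm N (pinned (D1 :&: D2) (U1 :|: U2))| * #|opm N (pinned (D1 :|: D2) (U1 :&: U2))|.
Proof.
apply: (@card_shift_join_meet _ _ y 0) => f g /opm_pinnedP[f1 f2 f3] /opm_pinnedP[g1 g2 g3].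
split; apply/opm_pinnedP; split.
- by move=> a b rab; apply: shift_join_lt; [apply: f1|apply: g1].
- by move=> a /setIP[a1 a2]; apply: shift_join_lt; [apply: f2|apply: g2].
- by move=> b /setUP[/f3 H|/g3 H]; apply: join_lt_center; rewrite H ?orbT.
- by move=> a b rab; apply: shift_meet_lt; [apply: f1|apply: g1].
- by move=> a /setUP[/f2 H|/g2 H]; apply: meet_lt_center; rewrite H ?orbT.
by move=> b /setIP[b1 b2]; apply: shift_meet_lt; [apply: f3|apply: g3].
Qed.

(** Dividing by [C * C] leaves errors of relative size [1 / M]. As [a * b] and [c * d] are integers,
    a violation would have size at least 1, and [M = 2 * (c + d + 1)] rules it out. *)
Lemma leq_of_asymptotic (a b c d : nat) :
  (forall M, exists C X, [/\ 0 < C, M * X <= C &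
     (a * C) * (b * C) <= (c * C + X) * (d * C + X)]) -> a * b <= c * d.
Proof.
move=> H; rewrite leqNgt; apply/negP => lt.
have [C [X [C0 MX]]] := H (2 * (c + d + 1)); apply/negP; rewrite -ltnNge.
have h1 : (c * d + 1) * (C * C) <= (a * b) * (C * C) by rewrite leq_mul2r addn1 lt orbT.
have h2 : X * X <= X * C.
  rewrite leq_mul2l; apply/orP; right; apply: leq_trans MX.
  by rewrite leq_pmull // muln_gt0 addn1.
have h3 : 2 * (c + d + 1) * X * C <= C * C by rewrite leq_mul2r MX orbT.
have CC : 0 < C * C by rewrite muln_gt0 C0.
have e : (c * C + X) * (d * C + X) = (c * d) * (C * C) + ((c + d) * (X * C) + X * X).
  rewrite mulnDl !mulnDr mulnACA -addnA; congr (_ + _); rewrite addnA; congr (_ + _).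
  by rewrite mulnDl (mulnC X (d * C)) -!mulnA (mulnC C X).
rewrite mulnACA e; apply: leq_trans h1; rewrite [X in _ < X]mulnDl mul1n ltn_add2l.
move: h3; rewrite -!mulnA (mulnDl _ 1) mul1n => h3.
by move: h2 h3 CC; clear; move: (X * C) (X * X) (C * C) => q u p; move: ((c + d) * q) => k; lia.
Qed.

(** Each linear extension accounts for ['C(N, n)] injective order-preserving maps, and the
    non-injective ones are negligible for large [N]; so the inequality for maps passes to the
    limit. *)
Lemma le_set_correlation D1 U1 D2 U2 :
  #|le_set (pinned D1 U1)| * #|le_set (pinned D2 U2)| <=
  #|le_set (pinned (D1 :&: D2) (U1 :|: U2))| * #|le_set (pinned (D1 :|: D2) (U1 :&: U2))|.
Proof.
apply: leq_of_asymptotic => M; have [N0 nN0 HN] := noninj_small #|T| M.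
exists 'C(N0, #|T|), (noninj T N0); split; [by rewrite bin_gt0 ltnW|exact: HN|].
rewrite -(card_inj_opm N0 (pinned D1 U1)) -(card_inj_opm N0 (pinned D2 U2)).
apply: leq_trans (leq_mul (inj_opm_sub N0 _) (inj_opm_sub N0 _)) _.
apply: leq_trans (card_opm_pinned _ _ _ _ _) _.
exact: leq_mul (card_opm_le _ _) (card_opm_le _ _).
Qed.

End Correlation.

(** * Gaps between elements of a random linear extension *)

Lemma card_ord_interval N a b : b <= N -> #|[set q : 'I_N | a <= q < b]| = b - a.
Proof.
move=> bN; case: (posnP (b - a)) => [E|ab].
  by rewrite E; apply/eqP; rewrite cards_eq0; apply/eqP/setP => q; rewrite !inE; lia.
have h (i : 'I_(b - a)) : a + i < N by have := ltn_ord i; lia.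
have hi : injective (fun i => Ordinal (h i)).
  by move=> i j /(congr1 val) /= E; apply: val_inj => /=; lia.
rewrite -[RHS]card_ord -cardsT -(card_imset _ hi); apply: eq_card => q; rewrite inE.
apply/idP/imsetP => [/andP[aq qb]|[i _ ->] /=]; last by have := ltn_ord i; lia.
have hq : q - a < b - a by lia.
by exists (Ordinal hq) => //; apply: val_inj => /=; lia.
Qed.

Lemma double_count (X Y Z : finType) (S : {set X}) (Q : X -> {set Y}) (F : X -> Y -> Z)
    (W : {set Z}) k :
  (forall x, x \in S -> k <= #|Q x|) ->
  (forall x y, x \in S -> y \in Q x -> F x y \in W) ->
  (forall x1 y1 x2 y2, x1 \in S -> y1 \in Q x1 -> x2 \in S -> y2 \in Q x2 ->
     F x1 y1 = F x2 y2 -> x1 = x2 /\ y1 = y2) ->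
  #|S| * k <= #|W|.
Proof.
move=> kQ FW Finj.
pose P := [set p : X * Y | (p.1 \in S) && (p.2 \in Q p.1)].
have lo : #|S| * k <= #|P|.
  rewrite -sum_nat_const -[#|P|]sum1_card.
  rewrite (eq_bigl (fun p : X * Y => (p.1 \in S) && (p.2 \in Q p.1))) => [|p]; last by rewrite inE.
  rewrite -(pair_big_dep (mem S) (fun x y => y \in Q x) (fun _ _ => 1)) /=.
  by apply: leq_sum => x xS; rewrite sum1_card kQ.
apply: leq_trans lo _.
have injP : {in P &, injective (fun p : X * Y => F p.1 p.2)}.
  move=> [x1 y1] [x2 y2]; rewrite !inE /= => /andP[s1 q1] /andP[s2 q2] E.
  by have [-> ->] := Finj _ _ _ _ s1 q1 s2 q2 E.
rewrite -(card_in_imset injP); apply: subset_leq_card; apply/subsetP => z.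
by case/imsetP => -[x w]; rewrite inE /= => /andP[xS wQ] ->; apply: FW.
Qed.

Lemma card_positions (T : finType) (g : {ffun T -> 'I_#|T|}) (P : pred 'I_#|T|) :
  injective g -> #|[set z | P (g z)]| = #|[set q | P q]|.
Proof.
move=> gi; rewrite -(card_imset _ gi); apply: eq_card => q; rewrite inE.
apply/imsetP/idP => [[z]|Pq]; first by rewrite inE => ? ->.
have /codomP[z qz] : q \in codom g by apply: inj_card_onto; rewrite ?card_ord.
by exists z => //; rewrite inE -qz.
Qed.

Section Spacing.
Variables (T : finType) (N : nat) (g : {ffun T -> 'I_#|T|}) (y v : T).
Hypothesis gi : injective g.
Let n := #|T|.

Lemma fiberP (f : {ffun T -> 'I_N}) :
  reflect (injective f /\ rank f = g) (f \in rank_fiber N g).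
Proof.
rewrite inE; apply: (iffP andP) => -[h1 h2]; split.
- exact/injectiveP.
- exact/eqP.
- exact/injectiveP.
exact/eqP.
Qed.

Lemma fiber_mono (f : {ffun T -> 'I_N}) a b : f \in rank_fiber N g -> (f a < f b) = (g a < g b).
Proof. by case/fiberP => _ <-; rewrite rank_mono. Qed.

Lemma fiber_rank (f : {ffun T -> 'I_N}) a : f \in rank_fiber N g ->
  #|[set q in f @: T | q < f a]| = g a.
Proof. by case/fiberP => fi <-; rewrite mem_imset_rank. Qed.

Lemma fiber_count (f : {ffun T -> 'I_N}) a b : f \in rank_fiber N g ->
  #|[set q : 'I_N in f @: T | f a <= q < f b]| = g b - g a.
Proof.
move=> fg; have /fiberP[fi _] := fg.
rewrite -(card_ord_interval (g a) (ltnW (ltn_ord (g b)))) -(card_positions _ gi).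
rewrite -(card_imset [set z | _] fi); apply: eq_card => q; rewrite !inE.
apply/andP/imsetP => [[/imsetP[z _ ->]]|[z]].
  by rewrite leqNgt !(fiber_mono _ _ fg) -leqNgt => h; exists z; rewrite ?inE.
by rewrite inE => h ->; rewrite imset_f //= leqNgt !(fiber_mono _ _ fg) -leqNgt.
Qed.

(** Such an [f] leaves at least [B.+1 - J] points of the interval from [f y] to [f v] outside its
    image. Adding one of them gives an [n.+1]-subset together with the rank of the new point, for
    which at most [J] values are possible; this pair determines both [f] and the point. *)
Lemma spacing_upper J B : g v <= g y + J -> J <= B ->
  #|[set f in rank_fiber N g | f y + B < f v]| * (B.+1 - J) <= J * 'C(N, n.+1).
Proof.
move=> gJ JB.
pose W := setX [set A : {set 'I_N} | #|A| == n.+1] [set k : 'I_n.+1 | (g y).+1 <= k < (g v).+1].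
apply: (@leq_trans #|W|); last first.
  rewrite cardsX card_draws card_ord card_ord_interval; last by rewrite ltnS ltnW.
  rewrite mulnC leq_mul2r; by apply/orP; right; lia.
pose Q (f : {ffun T -> 'I_N}) := [set q : 'I_N | f y <= q < f v] :\: [set q : 'I_N in f @: T | f y <= q < f v].
have rk_lt (f : {ffun T -> 'I_N}) (q : 'I_N) : f \in rank_fiber N g -> 
  q \in Q f -> g y < #|[set z in q |: f @: T | z < q]| <= g v.
  move=> fg; rewrite !inE => /andP[h /andP[yq qv]]; rewrite yq qv !andbT in h.
  rewrite -!(fiber_rank _ fg); apply/andP; split.
    have yq' : f y < q.
      by rewrite ltn_neqAle yq andbT; apply: contraNneq h => /val_inj <-; apply: imset_f.
    apply: proper_card; apply/properP; split.
      by apply/subsetP => z; rewrite !inE => /andP[-> zy]; rewrite orbT (ltn_trans zy).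
    by exists (f y); rewrite !inE ?ltnn ?andbF // yq' imset_f ?orbT.
  apply: subset_leq_card; apply/subsetP => z; rewrite !inE => /andP[/orP[/eqP ->|-> /= zq]].
    by rewrite ltnn.
  exact: ltn_trans zq qv.
have nQ (f : {ffun T -> 'I_N}) q : q \in Q f -> q \notin f @: T.
  by rewrite !inE => /andP[h /andP[a b]]; move: h; rewrite a b !andbT.
have rb (f : {ffun T -> 'I_N}) (q : 'I_N) : #|[set z in q |: f @: T | z < q]| < n.+1.
  apply: (@leq_ltn_trans #|f @: T|); last by rewrite ltnS leq_imset_card.
  apply: subset_leq_card; apply/subsetP => z; rewrite !inE => /andP[/orP[/eqP ->|//]].
  by rewrite ltnn.
apply: (@double_count _ _ _ _ Q (fun f q => (q |: f @: T, Ordinal (rb f q)))).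
- move=> f; rewrite inE => /andP[fg fB].
  rewrite cardsD (setIidPr _); last by apply/subsetP => q; rewrite !inE => /andP[].
  rewrite card_ord_interval ?(ltnW (ltn_ord _)) // fiber_count //; move: fB gJ => /=; lia.
- move=> f q; rewrite inE => /andP[fg fB] qQ; rewrite inE /=; apply/andP; split.
    have /fiberP[fi _] := fg; rewrite inE cardsU1 card_imset //.
    by rewrite (nQ _ _ qQ).
  by rewrite inE; apply: rk_lt.
move=> f1 q1 f2 q2 /setIdP[g1 _] /nQ h1 /setIdP[g2 _] /nQ h2 [] E Ek.
have q12 : q1 = q2.
  apply: (@card_lt_inj _ (q1 |: f1 @: T)); rewrite ?setU11 ?E ?setU11 //.
  by rewrite -Ek E.
split=> //; apply: (image_fiber_inj g1 g2) => /=.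
by rewrite -(setU1K h1) -(setU1K h2) E q12.
Qed.

(** Delete from the image the value of one of the at least [K] elements [z] after [y] and up to [v],
    recording [f z - f y < R]. The value [f y] still has rank [g y] in what remains, so [f z], and
    then [f], can be recovered. *)
Lemma spacing_lower K R : g y + K <= g v ->
  #|[set f in rank_fiber N g | f v < f y + R]| * K <= 'C(N, n.-1) * R.
Proof.
move=> gK; case: (posnP R) => [->|R0].
  rewrite muln0 (_ : [set _ in _ | _] = set0) ?cards0 //; apply/setP => f.
  rewrite in_set0; apply/negP => /setIdP[fg].
  by rewrite addn0 (fiber_mono _ _ fg); lia.
pose W := setX [set A : {set 'I_N} | #|A| == n.-1] [set k : 'I_R | 0 <= k < R].
apply: (@leq_trans #|W|); last first.
  by rewrite cardsX card_draws card_ord card_ord_interval // subn0.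
pose Q (f : {ffun T -> 'I_N}) := [set z | g y < g z <= g v].
pose F (f : {ffun T -> 'I_N}) z := (f @: T :\ f z, insubd (Ordinal R0) (f z - f y)).
have mid (f : {ffun T -> 'I_N}) z : f \in rank_fiber N g -> z \in Q f -> f y < f z <= f v.
  by move=> fg; rewrite inE => /andP[a b]; rewrite (fiber_mono _ _ fg) a leqNgt (fiber_mono _ _ fg) -leqNgt.
have rk (f : {ffun T -> 'I_N}) z : f \in rank_fiber N g -> z \in Q f ->
    #|[set q in f @: T :\ f z | q < f y]| = g y.
  move=> fg zQ; rewrite -(fiber_rank _ fg); apply: eq_card => q; rewrite !inE.
  case: (q =P f z) => [->|//] /=; have /andP[h _] := mid _ _ fg zQ.
  by rewrite ltnNge (ltnW h) andbF.
apply: (@double_count _ _ _ _ Q F).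
- move=> f /setIdP[fg fR]; rewrite (card_positions (fun q => g y < q <= g v) gi).
  by have := @card_ord_interval n (g y).+1 (g v).+1 (ltn_ord _); rewrite subSS => ->; lia.
- move=> f z /setIdP[fg fR] zQ; rewrite inE /=; apply/andP; split; last by rewrite inE ltn_ord.
  have /fiberP[fi _] := fg; rewrite inE.
  by have := cardsD1 (f z) (f @: T); rewrite imset_f // card_imset // => h; rewrite /n h.
move=> f1 z1 f2 z2 /setIdP[g1 b1] h1 /setIdP[g2 b2] h2 [] E Ek.
have m1 := mid _ _ g1 h1; have m2 := mid _ _ g2 h2.
have fy : f1 y = f2 y.
  apply: (@card_lt_inj _ (f1 @: T :\ f1 z1)).
  - by rewrite !inE imset_f // andbT; apply: contraTneq m1 => ->; rewrite ltnn.
  - by rewrite E !inE imset_f // andbT; apply: contraTneq m2 => ->; rewrite ltnn.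
  by rewrite (rk _ _ g1 h1) E (rk _ _ g2 h2).
have fz : f1 z1 = f2 z2.
  apply: val_inj; move: (congr1 val Ek); rewrite !val_insubd fy.
  by move: m1 m2 b1 b2; rewrite fy /=; case: ifP; case: ifP => /=; lia.
have f12 : f1 = f2.
  apply: (image_fiber_inj g1 g2) => /=.
  have i1 : f1 z1 \in f1 @: T by apply: imset_f.
  have i2 : f2 z2 \in f2 @: T by apply: imset_f.
  by rewrite -(setD1K i1) -(setD1K i2) E fz.
by split=> //; have /fiberP[fi _] := g2; apply: fi; rewrite -fz f12.
Qed.

End Spacing.

(** * Exponential decay of the gap between two elements *)

Section GapSets.
Variables (T : finType) (r : rel T) (N : nat) (y v : T).

Definition near_gap s B : {set {ffun T -> 'I_N}} :=
  [set f in opm N r | (f y + s <= f v + B) && (f v <= f y + s + B)].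
Definition far_gap R : {set {ffun T -> 'I_N}} := [set f in opm N r | f y + R <= f v].

(** For [f] with gap at most [B] in size and [g] with gap at least [R], the join has gap at least
    [R - s]; in the meet the minimum is attained by the gap of [f] plus [s], because
    [s + B <= R]. *)
Lemma gap_exchange s B R : s + B <= R ->
  #|near_gap 0 B| * #|far_gap R| <= #|far_gap (R - s)| * #|near_gap s B|.
Proof.
move=> sB; apply: (@card_shift_join_meet _ _ y s) => f g /setIdP[/opmP fo fB] /setIdP[/opmP go gR].
split; apply/setIdP; split.
- by apply/opmP => a b rab; apply: shift_join_lt; [apply: fo|apply: go].
- by move: fB gR; rewrite !fshift_joinE /shift_join /=; lia.
- by apply/opmP => a b rab; apply: shift_meet_lt; [apply: fo|apply: go].
by move: fB gR; rewrite !fshift_meetE /shift_meet /=; lia.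
Qed.

(** The windows centred at multiples of [B.*2.+1] are disjoint; if all [m] of them exceeded half of
    [near_gap 0 B], together they would exceed [opm N r]. *)
Lemma small_near_gap B m : #|opm N r| * 2 <= m * #|near_gap 0 B| -> 0 < m ->
  exists2 k, 0 < k <= m & #|near_gap (k * (B.*2.+1)) B| * 2 <= #|near_gap 0 B|.
Proof.
move=> Hm m0; set W := B.*2.+1.
case: (pickP (fun k : 'I_m => #|near_gap (k.+1 * W) B| * 2 <= #|near_gap 0 B|)) => [k Hk|no].
  by exists k.+1 => //; rewrite ltn_ord.
have: \sum_(k < m) #|near_gap (k.+1 * W) B| <= #|opm N r|.
  pose F (k : 'I_m) : {set {ffun T -> 'I_N}} := near_gap (k.+1 * W) B.
  rewrite (eq_bigr (fun k : 'I_m => \sum_(f in opm N r) (f \in F k))) => [|k _].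
    rewrite exchange_big /= -sum1_card; apply: leq_sum => f fo.
    case: (pickP (fun k => f \in F k)) => [k fk|nk]; last by rewrite big1 // => k _; rewrite nk.
    rewrite (bigD1 k) //= fk big1 ?addn0 // => j jk; case fj : (f \in F j) => //.
    move: fk fj; rewrite !inE => /andP[_ fk] /andP[_ fj].
    have : k = j :> nat by move: fk fj; rewrite /W; nia.
    by move/val_inj => kj; rewrite kj eqxx in jk.
  rewrite -sum1_card big_mkcond /= [RHS]big_mkcond; apply: eq_bigr => f _.
  rewrite -[near_gap _ _]/(F k); case fF : (f \in F k); last by rewrite if_same.
  by move: fF => /setIdP[-> _].
have : \sum_(k < m) #|near_gap 0 B| < \sum_(k < m) #|near_gap (k.+1 * W) B| * 2.
  have no' (k : 'I_m) : #|near_gap 0 B| < #|near_gap (k.+1 * W) B| * 2 by rewrite ltnNge no.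
  rewrite (bigD1 (Ordinal m0)) //= [X in _ < X](bigD1 (Ordinal m0)) //= -addSn.
  apply: leq_add; first exact: (no' (Ordinal m0)).
  by apply: leq_sum => k _; apply: ltnW.
rewrite -big_distrl /= sum_nat_const card_ord => h1 h2.
by have := leq_ltn_trans Hm h1; rewrite ltn_mul2r /= ltnNge h2.
Qed.


(** By [gap_exchange], raising the threshold by [s] at least halves [far_gap]. *)
Lemma far_gap_decay s B l : 0 < #|near_gap 0 B| -> #|near_gap s B| * 2 <= #|near_gap 0 B| ->
  #|far_gap (B + l * s)| * 2 ^ l <= #|opm N r|.
Proof.
move=> A0 As; elim: l => [|l IH].
  by rewrite expn0 muln1; apply: subset_leq_card; apply/subsetP => f /setIdP[].
apply: leq_trans IH; rewrite expnS mulnA leq_mul2r; apply/orP; right.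
have := @gap_exchange s B (B + l.+1 * s); rewrite mulSn.
have -> : B + (s + l * s) - s = B + l * s by lia.
move=> H; have {H} := H; have -> : s + B <= B + (s + l * s) by lia.
move=> /(_ isT).
move: As A0; move: #|near_gap 0 B| #|near_gap s B| #|far_gap _| #|far_gap _| => a b c d ba a0 h.
rewrite -(leq_pmul2l a0) mulnA; apply: leq_trans (_ : c * (b * 2) <= _).
  by rewrite mulnA leq_mul2r h.
by rewrite mulnC leq_mul2r ba orbT.
Qed.

End GapSets.

Section Tail.
Variables (T : finType) (r : rel T) (y v : T).
Let n := #|T|.

Definition close_to J : {set {ffun T -> 'I_#|T|}} :=
  [set g in le_set r | (g y <= g v + J) && (g v <= g y + J)].
Definition far_above K : {set {ffun T -> 'I_#|T|}} := [set g in le_set r | g y + K <= g v].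

Lemma card_subset_fiber N (X : {set {ffun T -> 'I_#|T|}}) (Z : {set {ffun T -> 'I_N}}) k :
  X \subset le_set r ->
  (forall g, g \in X -> k <= #|[set f in rank_fiber N g | f \in Z]| * 2) ->
  Z \subset opm N r ->
  #|X| * k <= #|Z| * 2.
Proof.
move=> XL Xk ZO.
apply: (@leq_trans (#|[set f in inj_opm N r | f \in Z]| * 2)); last first.
  by rewrite leq_mul2r /=; apply: subset_leq_card; apply/subsetP => f /setIdP[].
rewrite card_inj_opm_sum big_distrl -sum_nat_const [X in _ <= X](bigID (mem X)) /=.
apply: leq_trans (leq_addr _ _).
rewrite [X in _ <= X](eq_bigl (mem X)) => [|g]; first exact: leq_sum.
by rewrite /= andbC; case gX : (g \in X) => //=; apply: (subsetP XL).
Qed.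

(* Linear extensions cannot be shifted, so the count is done for order-preserving
   maps into a chain of length [N]; as [N] grows almost all of these are
   injective, and each linear extension is the ranking of 'C(N, n) of them. *)
Lemma tail_nat J h l : #|le_set r| <= h * #|close_to J| ->
  #|far_above (4 * (5 * J + l * (8 * h * (10 * J + 1)) + 1))| * 2 ^ l <= 4 * #|le_set r|.
Proof.
set rho := _ + 1; move=> Hh.
have [e0|e0] := posnP #|le_set r|.
  suff -> : #|far_above (4 * rho)| = 0 by rewrite mul0n.
  apply/eqP; rewrite -leqn0 -e0; apply: subset_leq_card; apply/subsetP => f /setIdP[] //.
have n0 : 0 < n by apply/card_gt0P; exists y.
have [N0 nN0 HN0] := noninj_small n 1.
(* [M] is the average spacing of the values of an injective map, so gaps in value are about [M]
   times gaps in position. *)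
pose M := N0 + 2; pose N := n * M.
have NN0 : N0 <= N by rewrite /N /M; nia.
have := HN0 _ NN0; rewrite mul1n -/(noninj T N) => HX.
set C := 'C(N, n) in HX.
have C0 : 0 < C by rewrite bin_gt0; lia.
have C1 : 'C(N, n.+1) <= M * C.
  have := mul_bin_left N n; rewrite -/C => E.
  rewrite -(@leq_pmul2l n.+1) // E mulnA leq_mul2r; apply/orP; right.
  by rewrite /N; nia.
have C2 : M * 'C(N, n.-1) <= 2 * C.
  have := mul_bin_left N n.-1; rewrite prednK // -/C => E.
  have h1 : n * (M - 1) <= N - n.-1 by rewrite /N; nia.
  have h2 : n * (M - 1) * 'C(N, n.-1) <= n * C by rewrite E leq_mul2r h1 orbT.
  rewrite -mulnA leq_pmul2l // in h2.
  apply: leq_trans (leq_mul (leqnn 2) h2); rewrite mulnA leq_mul2r; apply/orP; right.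
  by rewrite /M; lia.
(* Chosen so that in each fiber [spacing_upper] fails for at most a quarter of the maps; the two
   directions together lose at most half. *)
pose B := J * (4 * M + 1).
have BJ : J <= B by rewrite /B; nia.
have sub (X : {set {ffun T -> 'I_#|T|}}) : X \subset le_set r -> forall g, g \in X -> injective g /\
    (forall f : {ffun T -> 'I_N}, f \in rank_fiber N g -> f \in opm N r).
  move=> XL g gX; have gL := subsetP XL _ gX; have /le_setP[_ gi] := gL; split=> // f fg.
  by have /fiberP[fi rf] := fg; rewrite inj_opm_rank // rf.
have nearL : close_to J \subset le_set r by apply/subsetP => f /setIdP[].
have farL K : far_above K \subset le_set r by apply/subsetP => f /setIdP[].
have bad_up (g : {ffun T -> 'I_#|T|}) a b : injective g -> g b <= g a + J ->
    #|[set f in rank_fiber N g | f a + B < f b]| * 4 <= C.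
  move=> gi gab; have := @spacing_upper _ N _ a b gi J B gab BJ.
  have -> : B.+1 - J = 4 * J * M + 1 by rewrite /B; lia.
  move: #|_| C1 => bad; rewrite -/n; move: 'C(N, n.+1) C0 => C' C0.
  clear; move: C => c h1 h2; have h3 : J * C' <= J * (M * c) by rewrite leq_mul2l h1 orbT.
  have {h1 h2 h3} : bad * (4 * (J * M) + 1) <= (J * M) * c by rewrite -mulnA mulnA; lia.
  by move: (J * M) => q; nia.
have near : #|close_to J| * C <= #|near_gap r N y v 0 B| * 2.
  apply: card_subset_fiber => // [g gX|]; last by apply/subsetP => f /setIdP[].
  have [gi fo] := sub _ nearL g gX; move: gX => /setIdP[_ /andP[gy gv]].
  have h1 := bad_up g y v gi gv; have h2 := bad_up g v y gi gy.
  suff : C <= #|[set f in rank_fiber N g | f \in near_gap r N y v 0 B]| +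
    (#|[set f in rank_fiber N g | f y + B < f v]| + #|[set f in rank_fiber N g | f v + B < f y]|).
    by lia.
  rewrite /C -(card_rank_fiber N gi).
  apply: leq_trans (leq_add (leqnn _) (leq_card_setU _ _)).
  apply: leq_trans (leq_card_setU _ _); apply: subset_leq_card; apply/subsetP => f fg.
  case: (ltnP (f y + B) (f v)) => h3; first by apply/setUP; right; apply/setUP; left; apply/setIdP.
  case: (ltnP (f v + B) (f y)) => h4; first by apply/setUP; right; apply/setUP; right; apply/setIdP.
  apply/setUP; left; apply/setIdP; split=> //; apply/setIdP; split; first exact: fo.
  by rewrite !addn0 h3 h4.
have tot : #|opm N r| <= 2 * #|le_set r| * C.
  apply: leq_trans (card_opm_le _ _) _; rewrite -/n -/C.
  rewrite -mulnA mul2n -addnn leq_add2l.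
  by apply: leq_trans HX _; rewrite leq_pmull.
have big : #|le_set r| * C <= 2 * h * #|near_gap r N y v 0 B|.
  apply: (@leq_trans (h * (#|close_to J| * C))); first by rewrite mulnA leq_mul2r Hh orbT.
  by rewrite -mulnA (mulnCA 2) (mulnC 2) leq_mul2l near orbT.
have A0 : 0 < #|near_gap r N y v 0 B|.
  by move: big; case: posnP => // ->; rewrite muln0 leqn0 muln_eq0 !gtn_eqF.
have h0 : 0 < h by move: Hh; case: (h) => //; rewrite mul0n leqNgt e0.
(* The number [8 * h] of windows suffices: [opm N r] is at most twice [#|le_set r| * C], hence at
   most [4 * h] times [near_gap 0 B]. *)
have [||k /andP[k0 km] Hk] := @small_near_gap T r N y v B (8 * h); last first.
- set s := k * _ in Hk.
  have := far_gap_decay l A0 Hk; set R := B + l * s => dec.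
  have RM : R <= rho * M.
    have h1 : s <= 8 * h * ((10 * J + 1) * M) by apply: leq_mul => //; rewrite /B /M; nia.
    have h2 : l * s <= l * (8 * h * ((10 * J + 1) * M)) by rewrite leq_mul2l h1 orbT.
    have h3 : B <= 5 * J * M by rewrite /B /M; nia.
    rewrite /rho /R !mulnDl -!mulnA; move: h2 h3; rewrite !mulnA; lia.
  have far : #|far_above (4 * rho)| * C <= #|far_gap r N y v R| * 2.
    apply: card_subset_fiber => // [g gX|]; last by apply/subsetP => f /setIdP[].
    have [gi fo] := sub _ (farL _) g gX; move: gX => /setIdP[_ gv].
    (* The factor 4 in the position gap [4 * rho] cancels the 2 of [C2] and leaves a failure of at
       most one half. *)
    have h1 : #|[set f in rank_fiber N g | f v < f y + R]| * 2 <= C.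
      have := @spacing_lower _ N _ y v gi _ R gv; move: #|_| => bad h1.
      have h2 : 'C(N, n.-1) * R <= 'C(N, n.-1) * (rho * M) by rewrite leq_mul2l RM orbT.
      have rho0 : 0 < rho by rewrite /rho addn1.
      rewrite -(@leq_pmul2l (2 * rho)) ?muln_gt0 //.
      have h3 : rho * (M * 'C(N, n.-1)) <= rho * (2 * C) by rewrite leq_mul2l C2 orbT.
      have := leq_trans h1 h2; rewrite (mulnC 'C(N, n.-1)) -mulnA => /leq_trans/(_ h3).
      by rewrite -!mulnA mulnCA; lia.
    suff : C <= #|[set f in rank_fiber N g | f \in far_gap r N y v R]| +
      #|[set f in rank_fiber N g | f v < f y + R]| by lia.
    rewrite /C -(card_rank_fiber N gi).
    apply: leq_trans (leq_card_setU _ _); apply: subset_leq_card; apply/subsetP => f fg.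
    case: (ltnP (f v) (f y + R)) => h3; first by apply/setUP; right; apply/setIdP.
    by apply/setUP; left; apply/setIdP; split=> //; apply/setIdP; split; first exact: fo.
  have h1 := leq_trans dec tot.
  rewrite -(leq_pmul2r C0) mulnAC.
  apply: (@leq_trans (#|far_gap r N y v R| * 2 * 2 ^ l)); first by rewrite leq_mul2r far orbT.
  by rewrite mulnAC; lia.
- by rewrite muln_gt0 h0.
apply: (@leq_trans (2 * (2 * #|le_set r| * C))); first by rewrite mulnC leq_mul2l tot orbT.
by move: big; lia.
Qed.
End Tail.

(** * Probabilities over linear extensions *)

Section StrictOrder.
Variables (T : finType) (r : rel T).
Hypotheses (irr : irreflexive r) (tr : transitive r).

Lemma max_above (A : {set T}) z : z \in A ->
  exists m, [/\ m \in A, (z == m) || r z m & forall t, t \in A -> ~~ r m t].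
Proof.
move=> zA; pose Q m := (m \in A) && ((z == m) || r z m).
have Qz : Q z by rewrite /Q zA eqxx.
case: (@arg_maxnP _ z Q (fun m => #|[set t | r t m]|) Qz) => m /andP[mA zm] mx.
exists m; split=> // t tA; apply/negP => mt.
have Qt : Q t by rewrite /Q tA; case/orP: zm => [/eqP ->|/tr->]; rewrite ?mt ?orbT.
have := mx t Qt; rewrite /= leqNgt => /negP; apply; apply: proper_card; apply/properP; split.
  by apply/subsetP => s; rewrite !inE => /tr; apply.
by exists m; rewrite !inE ?irr.
Qed.

(** Sort by the number of predecessors and break ties by [enum_rank]; the lexicographic pair is
    written as one number in base [n]. *)
Lemma le_set_nonempty : (0 < #|le_set r|)%N.
Proof.
set n := #|T|; pose b x := #|[set t | r t x]|.
have bn x : (b x <= n)%N by rewrite /b /n max_card.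
have fb x : (b x * n + enum_rank x < n.+1 * n)%N.
  by have := ltn_ord (enum_rank x); have := bn x; rewrite -/n; nia.
pose f : {ffun T -> 'I_(n.+1 * n)} := [ffun x => Ordinal (fb x)].
have fi : injective f.
  move=> x y /(congr1 val); rewrite !ffunE /= => E; apply: enum_rank_inj; apply: val_inj => /=.
  by have := congr1 (modn^~ n) E; rewrite !modnMDl !modn_small.
apply/card_gt0P; exists (rank f); apply/le_setP; split; last exact: rank_inj.
move=> x y rxy; rewrite rank_mono !ffunE /=.
have : (b x < b y)%N.
  apply: proper_card; apply/properP; split.
    by apply/subsetP => s; rewrite !inE => /tr; apply.
  by exists x; rewrite !inE ?irr.
by have := ltn_ord (enum_rank x); rewrite -/n; nia.
Qed.

End StrictOrder.

Local Open Scope ring_scope.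

Section Probability.
Variables (R : realType) (T : finType) (r : rel T).
Implicit Types (E F : {ffun T -> 'I_#|T|} -> bool).

Definition pr E : R := #|[set g in le_set r | E g]|%:R / #|le_set r|%:R.

Definition plt x y : R := pr (fun g => (g x < g y)%N).

Lemma pr_ge0 E : 0 <= pr E.
Proof. by rewrite /pr divr_ge0 ?ler0n. Qed.

Lemma pr_mono E F : (forall g, g \in le_set r -> E g -> F g) -> pr E <= pr F.
Proof.
move=> EF; rewrite /pr ler_wpM2r ?invr_ge0 ?ler0n // ler_nat; apply: subset_leq_card.
by apply/subsetP => g /setIdP[gL Eg]; apply/setIdP; split; last exact: EF.
Qed.

Lemma pr_le1 E : pr E <= 1.
Proof.
rewrite /pr; have [->|e0] := posnP #|le_set r|; first by rewrite invr0 mulr0.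
rewrite ler_pdivrMr ?ltr0n // mul1r ler_nat; apply: subset_leq_card.
by apply/subsetP => g /setIdP[].
Qed.

Lemma prU E F : pr (fun g => E g || F g) <= pr E + pr F.
Proof.
rewrite /pr -mulrDl ler_wpM2r ?invr_ge0 ?ler0n // -natrD ler_nat.
apply: leq_trans (leq_card_setU _ _); apply: subset_leq_card.
apply/subsetP => g /setIdP[gL /orP[h|h]]; apply/setUP; [left|right]; exact/setIdP.
Qed.

Lemma pr_bigU (I : finType) (A : {set I}) (E : I -> {ffun T -> 'I_#|T|} -> bool) t :
  (forall i, i \in A -> pr (E i) <= t) ->
  pr (fun g => [exists i in A, E i g]) <= #|A|%:R * t.
Proof.
move: {2}#|A| (erefl #|A|) => k; elim: k A => [|k IH] A cA H.
  rewrite cA mul0r /pr (_ : [set _ in _ | _] = set0) ?cards0 ?mul0r //.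
  apply/setP => g; rewrite in_set in_set0; apply/negP => /andP[_ /existsP[i /andP[iA _]]].
  by move: cA => /eqP; rewrite cards_eq0 => /eqP A0; rewrite A0 inE in iA.
have /card_gt0P[i iA] : (0 < #|A|)%N by rewrite cA.
have cA' : #|A :\ i| = k by have := cardsD1 i A; rewrite iA cA; case.
rewrite cA -natr1 mulrDl mul1r -cA'.
apply: le_trans (_ : pr (fun g => [exists j in A :\ i, E j g] || E i g) <= _).
  apply: pr_mono => g _ /existsP[j /andP[jA Ej]].
  case: (j =P i) => [<-|/eqP ji]; first by rewrite Ej orbT.
  by apply/orP; left; apply/existsP; exists j; rewrite !inE ji jA.
apply: le_trans (prU _ _) _; apply: lerD; last exact: H.
by apply: IH => // j /setD1P[_]; apply: H.
Qed.

Lemma pr_gt0_ex E : 0 < pr E -> exists2 g, g \in le_set r & E g.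
Proof.
rewrite /pr => H; have : (0 < #|[set g in le_set r | E g]|)%N.
  by case: posnP H => // ->; rewrite mul0r ltxx.
by case/card_gt0P => g /setIdP[? ?]; exists g.
Qed.

(** Serves for contradictions: an element cannot take too many positions, each with probability
    bounded below. *)
Lemma pr_disjoint_sum S (E : nat -> {ffun T -> 'I_#|T|} -> bool) t :
  (forall s s' g, (s < s' <= S)%N -> E s g -> E s' g -> False) ->
  (forall s, (s <= S)%N -> t <= pr (E s)) -> S.+1%:R * t <= 1.
Proof.
move=> dis H; apply: le_trans (pr_le1 (fun g => [exists s : 'I_S.+1, E s g])).
have main k : (k <= S.+1)%N -> k%:R * t <= pr (fun g => [exists s : 'I_S.+1, (s < k)%N && E s g]).
  elim: k => [|k IH] kS; first by rewrite mul0r pr_ge0.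
  rewrite -natr1 mulrDl mul1r.
  apply: le_trans (lerD (IH (ltnW kS)) (H k kS)) _.
  rewrite /pr -mulrDl ler_wpM2r ?invr_ge0 ?ler0n // -natrD ler_nat.
  rewrite -[X in (X <= _)%N](cardsUI) (_ : _ :&: _ = set0) ?cards0 ?addn0.
    apply: subset_leq_card; apply/subsetP => g /setUP[|] /setIdP[gL].
      move=> /existsP[s /andP[sk Es]]; apply/setIdP; split=> //; apply/existsP; exists s.
      by rewrite Es ltnS ltnW.
    move=> Ek; apply/setIdP; split=> //; apply/existsP; exists (Ordinal kS).
    by rewrite /= Ek ltnSn.
  apply/setP => g; rewrite in_set0; apply/negP => /setIP[/setIdP[_ /existsP[s /andP[sk Es]]] /setIdP[_ Ek]].
  by apply: (dis s k g) => //; rewrite sk -ltnS.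
apply: le_trans (main S.+1 (leqnn _)) _; apply: pr_mono => g _ /existsP[s /andP[_ Es]].
by apply/existsP; exists s.
Qed.

Hypothesis e0 : (0 < #|le_set r|)%N.

Lemma prC E : pr (fun g => ~~ E g) = 1 - pr E.
Proof.
apply/eqP; rewrite eq_sym subr_eq; apply/eqP; rewrite /pr -mulrDl -natrD.
rewrite (_ : (_ + _)%N = #|le_set r|) ?divff ?pnatr_eq0 -?lt0n //.
rewrite -(cardsID [set g | E g] (le_set r)) addnC; congr (_ + _)%N.
  by apply: eq_card => g; rewrite !in_set.
by apply: eq_card => g; rewrite !in_set andbC.
Qed.

Lemma prI_ge E F : pr E + pr F - 1 <= pr (fun g => E g && F g).
Proof.
have := prU (fun g => ~~ E g) (fun g => ~~ F g).
have -> : pr (fun g => ~~ E g || ~~ F g) = pr (fun g => ~~ (E g && F g)).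
  by apply/eqP; rewrite eq_le; apply/andP; split; apply: pr_mono => g _; rewrite negb_and.
rewrite !prC; lra.
Qed.

Lemma prD_ge E F : pr E - pr F <= pr (fun g => E g && ~~ F g).
Proof. by have := prI_ge E (fun g => ~~ F g); rewrite prC; lra. Qed.

Lemma pr_lt_sym x y : x != y -> plt x y = 1 - plt y x.
Proof.
move=> xy; rewrite /plt -prC; apply/eqP; rewrite eq_le; apply/andP; split; apply: pr_mono => g gL.
  by rewrite -leqNgt => /ltnW.
rewrite -leqNgt leq_eqVlt => /orP[/eqP/val_inj|//].
by have /le_setP[_ gi] := gL => /gi E; rewrite E eqxx in xy.
Qed.

End Probability.

(** [tail_nat] with [h >= 1 / eta] and [2 ^ l >= 4 / th]. The point is that [K] does not depend on
    the poset. *)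
Lemma tail_real (R : realType) (J : nat) (eta th : R) : 0 < eta -> 0 < th ->
  exists K : nat, forall (T : finType) (r : rel T) (y v : T),
    eta <= pr R r (fun g => (g y <= g v + J)%N && (g v <= g y + J)%N) ->
    pr R r (fun g => (g y + K <= g v)%N) <= th.
Proof.
move=> eta0 th0.
pose h := Num.bound eta^-1; pose l := Num.bound (4 / th).
have hh : eta^-1 <= h%:R by rewrite ltW // archi_boundP // invr_ge0 ltW.
have ll : 4 / th <= (2 ^ l)%:R.
  apply: (@le_trans _ _ l%:R); first by rewrite ltW // archi_boundP // divr_ge0 // ltW.
  by rewrite ler_nat ltnW // ltn_expl.
exists (4 * (5 * J + l * (8 * h * (10 * J + 1)) + 1))%N => T r y v H.
have [e0|e0] := posnP #|le_set r|.
  by move: H; rewrite /pr e0 invr0 mulr0 => /(lt_le_trans eta0); rewrite ltxx.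
have e0R : 0 < #|le_set r|%:R :> R by rewrite ltr0n.
have : (#|le_set r| <= h * #|close_to r y v J|)%N.
  move: H; rewrite /pr ler_pdivlMr // => H; rewrite -(ler_nat R) natrM.
  rewrite -(@ler_pM2l _ eta) // mulrA.
  apply: le_trans H _; rewrite -[leLHS]mul1r ler_wpM2r ?ler0n //.
  by rewrite -ler_pdivrMl // mulr1.
move/(@tail_nat T r y v J h l) => Ht.
rewrite /pr ler_pdivrMr // -(@ler_pM2r _ (2 ^ l)%:R) ?ltr0n ?expn_gt0 //.
rewrite -natrM; apply: (@le_trans _ _ (4 * #|le_set r|)%:R); first by rewrite ler_nat.
rewrite natrM mulrAC ler_wpM2r ?ler0n //.
by rewrite -ler_pdivrMl // mulrC.
Qed.

(** * Posets without a nearly balanced pair *)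

(** Stated for a relation instead of an ordered type, so that it also applies to the converse
    order. *)
Definition unbalanced (R : realType) (eps : R) (w : nat) (T : finType) (r : rel T) : Prop :=
  [/\ irreflexive r, transitive r,
      forall x y, x != y -> plt R r x y <= 1 / 2 - eps \/
                            1 / 2 + eps <= plt R r x y
    & forall A : {set T}, (forall x y, x \in A -> y \in A -> ~~ r x y) -> (#|A| <= w)%N].

Section Cut.
Variables (R : realType) (T : finType) (r : rel T).

Definition dn y : {set T} := [set z | (z != y) && (1 / 2 < plt R r z y)].
Definition up y : {set T} := [set z | (z != y) && (1 / 2 < plt R r y z)].
Definition cut y (g : {ffun T -> 'I_#|T|}) : bool :=
  [forall z, ((z \in dn y) ==> (g z < g y)%N) && ((z \in up y) ==> (g y < g z)%N)].

Lemma cutP y (g : {ffun T -> 'I_#|T|}) :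
  reflect ((forall z, z \in dn y -> (g z < g y)%N) /\
           (forall z, z \in up y -> (g y < g z)%N)) (cut y g).
Proof.
apply: (iffP forallP) => [H|[H1 H2] z]; last by apply/andP; split; apply/implyP; auto.
by split=> z zy; have /andP[/implyP h1 /implyP h2] := H z; auto.
Qed.

Definition pin y (D U : {set T}) (g : {ffun T -> 'I_#|T|}) : bool :=
  [forall d in D, (g d < g y)%N] && [forall u in U, (g y < g u)%N].

Lemma le_set_pinned y D U : le_set (pinned r y D U) = [set g in le_set r | pin y D U g].
Proof.
apply/setP => g; apply/le_setP/setIdP => [[H gi]|[/le_setP[H gi] /andP[/forall_inP HD /forall_inP HU]]].
  have /opm_pinnedP[h1 h2 h3] : g \in opm _ (pinned r y D U) by apply/opmP.
  by split; [apply/le_setP|apply/andP; split; apply/forall_inP].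
by split=> //; apply/opmP/opm_pinnedP.
Qed.

Lemma pr_correlation y D1 U1 D2 U2 :
  pr R r (pin y D1 U1) * pr R r (pin y D2 U2) <=
  pr R r (pin y (D1 :&: D2) (U1 :|: U2)) * pr R r (pin y (D1 :|: D2) (U1 :&: U2)).
Proof.
rewrite /pr -!le_set_pinned !mulf_div ler_wpM2r ?invr_ge0 -?natrM ?ler0n //.
by rewrite ler_nat le_set_correlation.
Qed.

Lemma pin_anti y (D U D' U' : {set T}) (g : {ffun T -> 'I_#|T|}) :
  D' \subset D -> U' \subset U -> pin y D U g -> pin y D' U' g.
Proof.
move=> /subsetP DD /subsetP UU /andP[/forall_inP HD /forall_inP HU].
by apply/andP; split; apply/forall_inP => z ?; [apply/HD/DD|apply/HU/UU].
Qed.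

End Cut.

(** By supermodularity, adding [d] to any set multiplies [a] by at least the ratio of [a [set d]] to
    [a set0], hence by at least [th]; build [D] up one element at a time. *)
Lemma supermodular_lower_bound (R : realType) (T : finType) (a : {set T} -> R)
    (th : R) (D : {set T}) :
  0 <= th -> (forall A, 0 <= a A) ->
  (forall A d, a A * a [set d] <= a (d |: A) * a set0) ->
  (forall d, d \in D -> th * a set0 <= a [set d]) ->
  th ^+ #|D| * a set0 <= a D.
Proof.
move=> th0 a0 asup; move: {2}#|D| (erefl #|D|) => k; elim: k D => [|k IH] D cD H.
  by rewrite cD mul1r; move/eqP: cD; rewrite cards_eq0 => /eqP ->.
have /card_gt0P[i iD] : (0 < #|D|)%N by rewrite cD.
have cD' : #|D :\ i| = k by have := cardsD1 i D; rewrite iD cD; case.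
have := IH _ cD' (fun d => fun h => H d (proj2 (setD1P h))).
rewrite cD cD' => h1; have h2 := asup (D :\ i) i; rewrite setD1K // in h2.
have [e0|e0] := eqVneq (a set0) 0; first by rewrite e0 mulr0.
have e1 : 0 < a set0 by rewrite lt_def e0 a0.
rewrite -(ler_pM2r e1); apply: le_trans h2.
rewrite exprS mulrAC -!mulrA mulrA; apply: le_trans (ler_pM _ _ h1 (H i iD)).
- by rewrite le_eqVlt; apply/orP; left; apply/eqP; ring.
- by rewrite mulr_ge0 // exprn_ge0.
by rewrite mulr_ge0.
Qed.

Lemma pr_all (R : realType) (T : finType) (r : rel T) (E : {ffun T -> 'I_#|T|} -> bool) :
  (0 < #|le_set r|)%N -> (forall g, g \in le_set r -> E g) -> pr R r E = 1.
Proof.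
move=> e0 H; rewrite /pr (_ : [set _ in _ | _] = le_set r) ?divff ?pnatr_eq0 -?lt0n //.
by apply/setP => g; rewrite in_set; case gL : (g \in le_set r) => //=; apply: H.
Qed.

(** * The sets [dn y] and [up y], and the probability that [y] separates them *)

Section Unbalanced.
Variables (R : realType) (eps : R) (w : nat) (T : finType) (r : rel T).
Hypothesis eps0 : 0 < eps.
Hypothesis un : unbalanced eps w r.

Lemma un_irr : irreflexive r. Proof. by case: un. Qed.
Lemma un_tr : transitive r. Proof. by case: un. Qed.
Lemma un_le0 : (0 < #|le_set r|)%N. Proof. exact: le_set_nonempty un_irr un_tr. Qed.

Lemma dn_up x y : (x \in dn R r y) = (y \in up R r x).
Proof. by rewrite !inE eq_sym. Qed.

Lemma dnU y z : z != y -> (z \in dn R r y) || (z \in up R r y).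
Proof.
have e0 := eps0.
move=> zy; rewrite !inE zy /=.
have [_ _ /(_ z y zy) H _] := un; have := pr_lt_sym R un_le0 zy.
by case: H => H E; apply/orP; [right|left]; lra.
Qed.

Lemma dn_gt y z : z \in dn R r y -> 1 / 2 + eps <= plt R r z y.
Proof.
have e0 := eps0.
rewrite inE => /andP[zy H]; have [_ _ /(_ z y zy) H' _] := un; case: H' => //; lra.
Qed.

Lemma up_gt y z : z \in up R r y -> 1 / 2 + eps <= plt R r y z.
Proof. by rewrite -dn_up; apply: dn_gt. Qed.

Lemma dn_not_up y z : z \in dn R r y -> z \notin up R r y.
Proof.
have e0 := eps0.
move=> h; apply/negP => h'; have := dn_gt h; have := up_gt h'.
have zy : z != y by move: h; rewrite inE => /andP[].
rewrite (pr_lt_sym R un_le0 zy); lra.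
Qed.

Lemma rel_dn x y : r x y -> x \in dn R r y.
Proof.
have e0 := eps0.
move=> rxy; rewrite inE; apply/andP; split.
  by apply: contraTneq rxy => ->; rewrite un_irr.
rewrite /plt pr_all ?un_le0 //; last by move=> g /le_setP[H _]; apply: H.
lra.
Qed.

Lemma rel_up x y : r x y -> y \in up R r x.
Proof. by rewrite -dn_up; apply: rel_dn. Qed.

Lemma dn_down x y z : r z x -> x \in dn R r y -> z \in dn R r y.
Proof.
have e0 := eps0.
move=> rzx xy; have h := dn_gt xy.
have h2 : plt R r x y <= plt R r z y.
  by apply: pr_mono => g /le_setP[H _]; apply: ltn_trans; apply: H.
rewrite inE; apply/andP; split; last by lra.
apply: contraTneq rzx => zy; apply/negP => /rel_dn h'.
by have := dn_not_up xy; rewrite -dn_up -zy h'.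
Qed.

Lemma up_up x y z : r x z -> x \in up R r y -> z \in up R r y.
Proof.
have e0 := eps0.
move=> rxz xy; have h := up_gt xy.
have h2 : plt R r y x <= plt R r y z.
  by apply: pr_mono => g /le_setP[H _] /ltn_trans; apply; apply: H.
rewrite inE; apply/andP; split; last by lra.
apply: contraTneq rxz => zy; apply/negP => /rel_dn h'.
by have := dn_not_up h'; rewrite zy xy.
Qed.

(** The maximal elements of [A] form an antichain, so a claim that all of [A] comes early reduces to
    at most [w] elements. *)
Lemma maxset_dn (A : {set T}) : exists2 M : {set T}, (#|M| <= w)%N &
  M \subset A /\ forall z, z \in A -> exists2 m, m \in M & (z == m) || r z m.
Proof.
have e0 := eps0.
exists [set m in A | [forall t in A, ~~ r m t]].
  have [_ _ _] := un; apply=> x z /setIdP[_ /forall_inP H] /setIdP[zA _]; exact: H.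
split=> [|z zA]; first by apply/subsetP => m /setIdP[].
have [m [mA zm mx]] := max_above un_irr un_tr zA.
by exists m => //; apply/setIdP; split=> //; apply/forall_inP.
Qed.

Lemma minset_up (A : {set T}) : exists2 M : {set T}, (#|M| <= w)%N &
  M \subset A /\ forall z, z \in A -> exists2 m, m \in M & (z == m) || r m z.
Proof.
have e0 := eps0.
exists [set m in A | [forall t in A, ~~ r t m]].
  have [_ _ _] := un; apply=> x z /setIdP[xA _] /setIdP[_ /forall_inP H]; exact: H.
split=> [|z zA]; first by apply/subsetP => m /setIdP[].
have tr' : transitive (fun x y => r y x) by move=> x1 x2 x3 h1 h2; apply: un_tr h2 h1.
have [m [mA zm mx]] := @max_above _ (fun x y => r y x) un_irr tr' A z zA.
by exists m => //; apply/setIdP; split=> //; apply/forall_inP.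
Qed.

Lemma pin_pair y d u : d \in dn R r y -> u \in up R r y ->
  2 * eps <= pr R r (pin y [set d] [set u]).
Proof.
have e0 := eps0.
move=> /dn_gt h1 /up_gt h2.
apply: (@le_trans _ _ (pr R r (fun g => (g d < g y)%N && (g y < g u)%N))).
  apply: le_trans (prI_ge R un_le0 _ _).
  by rewrite -/(plt R r d y) -/(plt R r y u); lra.
apply: pr_mono => g _ /andP[dy yu]; apply/andP; split; apply/forall_inP => z.
  by rewrite inE => /eqP ->.
by rewrite inE => /eqP ->.
Qed.

(** Correlation with the same upper set twice; the intersection of the lower sets is then weakened
    to the empty set. *)
Lemma pin_dn_supermodular y U A d :
  pr R r (pin y A U) * pr R r (pin y [set d] U) <=
  pr R r (pin y (d |: A) U) * pr R r (pin y set0 U).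
Proof.
have e0 := eps0.
apply: le_trans (pr_correlation _ _ _ _ _ _ _) _; rewrite setIid setUid mulrC setUC.
by apply: ler_wpM2l; [exact: pr_ge0|apply: pr_mono => g _; apply: pin_anti => //; apply: sub0set].
Qed.

Lemma pin_up_supermodular y D A u :
  pr R r (pin y D A) * pr R r (pin y D [set u]) <=
  pr R r (pin y D (u |: A)) * pr R r (pin y D set0).
Proof.
have e0 := eps0.
apply: le_trans (pr_correlation _ _ _ _ _ _ _) _; rewrite setIid setUid setUC.
by apply: ler_wpM2l; [exact: pr_ge0|apply: pr_mono => g _; apply: pin_anti => //; apply: sub0set].
Qed.

Hypothesis eps1 : eps <= 1 / 2.

Definition cut_const : R := ((2 * eps) ^+ w / 2) ^+ w * (1 / 2) ^+ w.

(** It suffices to put the maximal elements [D] of [dn y] before [y] and the minimal elements [U] of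
    [up y] after it. By supermodularity the first costs at most a factor 1/2 per element; then each
    element of [U] costs at most the factor [(2 * eps) ^+ w / 2]. *)
Lemma cut_prob y : cut_const <= pr R r (cut R r y).
Proof.
have e0 := eps0; have e1 := eps1.
have [D Dw [Ds Dmax]] := maxset_dn (dn R r y).
have [U Uw [Us Umin]] := minset_up (up R r y).
have pin_cut : pr R r (pin y D U) <= pr R r (cut R r y).
  apply: pr_mono => g /le_setP[H _] /andP[/forall_inP HD /forall_inP HU]; apply/cutP; split=> z zy.
    by have [m mD /orP[/eqP -> |/H zm]] := Dmax z zy; [|apply: ltn_trans zm _]; apply: HD.
  by have [m mD /orP[/eqP -> |/H zm]] := Umin z zy; [|apply: ltn_trans zm]; apply: HU.
apply: le_trans pin_cut.
have le_w (x : R) (A : {set T}) : 0 <= x <= 1 -> (#|A| <= w)%N -> x ^+ w <= x ^+ #|A|.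
  by move=> /andP[x0 x1] Aw; apply: ler_wiXn2l.
have e01 : 0 <= 2 * eps <= 1 by move: eps0 eps1 => ? ?; apply/andP; split; lra.
have pin0 (g : {ffun T -> 'I_#|T|}) : pin y set0 set0 g.
  by apply/andP; split; apply/forall_inP => z; rewrite inE.
have hD0 : (1 / 2) ^+ w <= pr R r (pin y D set0).
  apply: (@le_trans _ _ ((1 / 2) ^+ #|D| * pr R r (pin y set0 set0))).
    by rewrite pr_all ?un_le0 // mulr1; apply: le_w => //; apply/andP; split; lra.
  apply: (supermodular_lower_bound (a := fun A => pr R r (pin y A set0))) => //; first by lra.
  - by move=> A; apply: pr_ge0.
  - by move=> A d; apply: pin_dn_supermodular.
  move=> d dD; rewrite pr_all ?un_le0 // mulr1.
  have := dn_gt (subsetP Ds d dD) => h; apply: (@le_trans _ _ (1 / 2 + eps)); first by lra.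
  apply: le_trans h _; apply: pr_mono => g _ h; apply/andP; split; apply/forall_inP => z.
    by rewrite inE => /eqP ->.
  by rewrite inE.
(* Having [u] after [y] costs 1/2. With this imposed, each [d] costs a factor [2 * eps], as [d]
   before [y] before [u] has at least that probability by [pin_pair]. *)
have hDu u : u \in U -> (2 * eps) ^+ w / 2 <= pr R r (pin y D [set u]).
  move=> uU; have uu := subsetP Us u uU.
  have h0 : 1 / 2 <= pr R r (pin y set0 [set u]).
    have := up_gt uu => h; apply: (@le_trans _ _ (1 / 2 + eps)); first by lra.
    apply: le_trans h _; apply: pr_mono => g _ h; apply/andP; split; apply/forall_inP => z.
      by rewrite inE.
    by rewrite inE => /eqP ->.
  apply: (@le_trans _ _ ((2 * eps) ^+ #|D| * pr R r (pin y set0 [set u]))).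
    by apply: ler_pM; [rewrite exprn_ge0 //; case/andP: e01|lra|exact: le_w|lra].
  apply: (supermodular_lower_bound (a := fun A => pr R r (pin y A [set u]))) => //.
  - by case/andP: e01.
  - by move=> A; apply: pr_ge0.
  - by move=> A d; apply: pin_dn_supermodular.
  move=> d dD; apply: le_trans (pin_pair (subsetP Ds d dD) uu).
  by rewrite ler_piMr ?pr_le1 //; case/andP: e01.
have e2 : 0 <= (2 * eps) ^+ w / 2 <= 1.
  case/andP: e01 => e3 e4; have := exprn_ge0 w e3; have := exprn_ile1 w e3 e4 => h1 h2.
  by apply/andP; split; lra.
apply: (@le_trans _ _ (((2 * eps) ^+ w / 2) ^+ #|U| * pr R r (pin y D set0))).
  by apply: ler_pM; [rewrite exprn_ge0 //; case/andP: e2|rewrite exprn_ge0 //; lra|exact: le_w|].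
apply: (supermodular_lower_bound (a := fun A => pr R r (pin y D A))) => //.
- by case/andP: e2.
- by move=> A; apply: pr_ge0.
- by move=> A d; apply: pin_up_supermodular.
move=> u uU; apply: le_trans (hDu u uU).
by rewrite ler_piMr ?pr_le1 //; case/andP: e2.
Qed.

Lemma cut_const_gt0 : 0 < cut_const.
Proof.
have e0 := eps0.
have e3 : 0 < 2 * eps by lra.
by rewrite /cut_const mulr_gt0 // exprn_gt0 // ?divr_gt0 // exprn_gt0.
Qed.

End Unbalanced.

(** If [v] is not [u], then [a] before [u] before [v] has probability at least [2 * eps]. As [a] and
    [v] are close with probability [eta], they are at distance [K1] or more with probability at most
    [eps]; so [u] is within [K1] of [a] with probability at least [eps], and the tail bound applies
    to this pair. *)
Lemma crossing_tail (R : realType) (eps : R) (w J : nat) (eta dl : R) :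
  0 < eps -> 0 < eta -> 0 < dl ->
  exists k : nat, forall (T : finType) (r : rel T), unbalanced eps w r ->
    forall a u v, a \in dn R r u -> v \notin dn R r u ->
    eta <= pr R r (fun g => (g a < g v)%N && (g v <= g a + J)%N) ->
    pr R r (fun g => (g u + k <= g a)%N) <= dl.
Proof.
move=> eps0 eta0 dl0.
have [K1 H1] := tail_real J eta0 eps0.
have [K2 H2] := tail_real J eta0 dl0.
have [K3 H3] := tail_real K1 eps0 dl0.
exists (K2 + K3)%N => T r un a u v au vu av.
have [vu'|vu'] := eqVneq v u.
  subst v; apply: le_trans (H2 T r u a _); first by apply: pr_mono => g _; clear; lia.
  by apply: le_trans av _; apply: pr_mono => g _; clear; lia.
have uv : v \in up R r u by have := dnU eps0 un vu'; rewrite (negPf vu).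
apply: le_trans (H3 T r u a _); first by apply: pr_mono => g _; clear; lia.
have h1 : pr R r (fun g => (g a + K1 <= g v)%N) <= eps.
  by apply: H1; apply: le_trans av _; apply: pr_mono => g _; clear; lia.
have h2 := prI_ge R (un_le0 un) (fun g => (g a < g u)%N) (fun g => (g u < g v)%N).
have h3 := prD_ge R (un_le0 un) (fun g => (g a < g u)%N && (g u < g v)%N) (fun g => (g a + K1 <= g v)%N).
have := dn_gt eps0 un au; have := up_gt eps0 un uv; rewrite /plt => h4 h5.
apply: (@le_trans _ _ (pr R r (fun g => ((g a < g u)%N && (g u < g v)%N) && ~~ (g a + K1 <= g v)%N))).
  by lra.
apply: pr_mono => g _ /andP[/andP[x1 x2]]; rewrite -ltnNge => x3.
by apply/andP; split; move: x1 x2 x3; clear; lia.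
Qed.

(** * Elements shortly after [y], and tail bounds for [dn y] *)

Section Followers.
Variables (R : realType) (eps : R) (w : nat) (T : finType) (r : rel T).
Hypothesis eps0 : 0 < eps.
Hypothesis un : unbalanced eps w r.

(** No pair is balanced, so every element other than [y] is in [dn y] or in [up y]; exactly [dn y]
    precedes [y]. *)
Lemma cut_pos y (g : {ffun T -> 'I_#|T|}) :
  g \in le_set r -> cut R r y g -> g y = #|dn R r y| :> nat.
Proof.
move=> /le_setP[_ gi] /cutP[Hd Hu].
have := card_positions (fun q : 'I_#|T| => (0 <= q < g y)%N) gi.
rewrite card_ord_interval ?subn0 ?(ltnW (ltn_ord _)) // => <-.
apply: eq_card => z; rewrite in_set /=; apply/idP/idP => [zy|/Hd //].
have zy' : z != y by apply: contraTneq zy => ->; rewrite ltnn.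
by have := dnU eps0 un zy'; case/orP => // /Hu h; have := ltn_trans zy h; rewrite ltnn.
Qed.

(** Contains every element that can sit within [m] places after [y] when [y] is cut. Passing from
    [m] to [m.+1] adds an antichain, whence the bound [w * m]. *)
Definition up_level y m : {set T} :=
  [set z in up R r y | (#|[set t in up R r y | r t z]| < m)%N].

Lemma card_up_level y m : (#|up_level y m| <= w * m)%N.
Proof.
elim: m => [|m IH].
  rewrite muln0 leqn0 cards_eq0; apply/eqP/setP => z; rewrite in_set in_set0 ltn0; lia.
rewrite mulnS addnC -(cardsID (up_level y m) (up_level y m.+1)); apply: leq_add.
  by apply: leq_trans IH; apply: subset_leq_card; apply: subsetIr.
have [_ tr _ anti] := un; apply: anti => x z /setDP[/setIdP[xu x1] xn] /setDP[/setIdP[zu z1] zn].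
apply/negP => xz.
have {xn} xm : (m <= #|[set t in up R r y | r t x]|)%N.
  by rewrite leqNgt; apply: contra xn => h; apply/setIdP.
have : (#|[set t in up R r y | r t x]| < #|[set t in up R r y | r t z]|)%N.
  apply: proper_card; apply/properP; split.
    by apply/subsetP => t; rewrite !in_set => /andP[-> /tr]; apply.
  by exists x; rewrite in_set ?xu ?xz // (un_irr un).
by lia.
Qed.

Lemma follower_mem y m z (g : {ffun T -> 'I_#|T|}) : g \in le_set r -> cut R r y g ->
  g z = (g y + m.+1)%N :> nat -> z \in up_level y m.+1.
Proof.
move=> gL /cutP[Hd Hu] gz; have /le_setP[go gi] := gL.
have zy : z != y by apply/eqP => E; move: gz; rewrite E; lia.
have zu : z \in up R r y by have := dnU eps0 un zy; case/orP => // /Hd h; exfalso; move: gz h; clear; lia.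
apply/setIdP; split=> //; rewrite ltnS.
have := card_positions (fun q : 'I_#|T| => ((g y).+1 <= q < g z)%N) gi.
rewrite card_ord_interval ?(ltnW (ltn_ord _)) //.
have -> : (g z - (g y).+1 = m)%N by lia.
move=> <-; apply: subset_leq_card; apply/subsetP => t /setIdP[tu tz].
by rewrite in_set (go _ _ tz) (Hu _ tu).
Qed.

(** Pigeonhole: given [E], the element at distance [m.+1] after [y] is one of at most [w * m.+1]
    candidates. The extra factor 2 makes the inequality strict enough for a contradiction. *)
Lemma follower_exists y m (E : {ffun T -> 'I_#|T|} -> bool) eta : 0 < eta ->
  (forall g, E g -> cut R r y g) -> (#|dn R r y| + m.+1 < #|T|)%N -> eta <= pr R r E ->
  exists v, eta / (2 * w.+1 * m.+1)%:R <=
    pr R r (fun g => E g && (g v == g y + m.+1 :> nat)%N).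
Proof.
move=> eta0 Ecut small HE; set q := (_ * m.+1)%N.
have q0 : 0 < q%:R :> R by rewrite ltr0n.
case: (pickP (fun v => eta / q%:R <= pr R r (fun g => E g && (g v == g y + m.+1 :> nat)%N))) => [v Hv|no].
  by exists v.
have : pr R r E <= #|up_level y m.+1|%:R * (eta / q%:R).
  apply: le_trans (pr_bigU (A := up_level y m.+1)
    (E := fun v g => E g && (g v == g y + m.+1 :> nat)%N) _); last first.
    by move=> v _; apply: ltW; rewrite ltNge; apply: negbT (no v).
  apply: pr_mono => g gL Eg; have /le_setP[_ gi] := gL.
  have gy := cut_pos gL (Ecut g Eg).
  have /codomP[v gv] : Ordinal small \in codom g by apply: inj_card_onto; rewrite ?card_ord.
  have gv' : g v = (g y + m.+1)%N :> nat by rewrite -gv gy.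
  apply/existsP; exists v; rewrite Eg gv' eqxx /= andbT.
  exact: follower_mem gL (Ecut g Eg) gv'.
move=> h; have := le_trans HE h.
have : #|up_level y m.+1|%:R * (eta / q%:R) <= (w * m.+1)%:R * (eta / q%:R).
  by rewrite ler_wpM2r ?divr_ge0 ?(ltW eta0) ?ler0n // ler_nat card_up_level.
have h2 : (w * m.+1)%:R * (eta / q%:R) <= eta / 2.
  have hq : 2 * (w * m.+1)%:R <= q%:R :> R by rewrite -natrM ler_nat /q; clear; lia.
  have := ler_wpM2r (ltW eta0) hq; rewrite mulrA ler_pdivrMr //.
  by move: (w * m.+1)%:R => W; lra.
lra.
Qed.

End Followers.

(** [S] is an antichain of maximal elements of [dn u], and [m] exceeds the number of elements by
    which it can still grow. Consider an element [v] that, with probability bounded below, sits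
    [K.+1] places after [b] while nothing of [S] lies that far. If [v] is outside [dn u],
    [crossing_tail] bounds [b]. Otherwise a maximal [b1] of [dn u] above [v] is not in [S], and [b]
    is rarely far above [b1]; so induction on [m] applies to [b1 |: S]. Each round costs one more
    [kp]. *)
Lemma late_maximal_tail (R : realType) (eps : R) (w : nat) (kp : R) :
  0 < eps -> eps <= 1 / 2 -> 0 < kp -> (2 * w.+1 * w.+1)%:R * kp <= cut_const eps w ->
  forall m K, (m <= w)%N -> exists k : nat, forall (T : finType) (r : rel T), unbalanced eps w r ->
    forall u (S : {set T}) b, S \subset dn R r u ->
      (forall s t, s \in S -> t \in dn R r u -> ~~ r s t) -> b \in S -> (w < #|S| + m)%N ->
      (forall b', b' \in S -> pr R r (fun g => (g b + K.+1 <= g b')%N) <= (w.+1 - m)%:R * kp) ->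
      pr R r (fun g => (g u + k <= g b)%N) <= m%:R * kp.
Proof.
move=> eps0 eps1 kp0 kpc; set c := cut_const eps w in kpc.
have c0 : 0 < c by apply: cut_const_gt0.
elim=> [|m IH] K mw.
  exists 0%N => T r un u S b Su Smax bS; rewrite addn0 => Sw.
  have [_ _ _ anti] := un.
  have : (#|S| <= w)%N by apply: anti => x y xS yS; apply: Smax => //; apply: (subsetP Su).
  by move: Sw; clear; lia.
pose q := (2 * w.+1 * K.+1)%N; pose eta := c / 2 / q%:R.
have c20 : 0 < c / 2 by rewrite divr_gt0.
have eta0 : 0 < eta by rewrite divr_gt0 // ltr0n.
have [k1 H1] := @crossing_tail R eps w K.+1 c kp eps0 c0 kp0.
have [k2 H2] := @crossing_tail R eps w K.+1 eta kp eps0 eta0 kp0.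
have [K' H3] := @tail_real R K.+1 eta kp eta0 kp0.
have [k0 H0] := IH (K + K')%N (ltnW mw).
exists (k1 + k2 + (k0 + K'))%N => T r un u S b Su Smax bS Sw Sb.
have bu := subsetP Su b bS.
have Sw' : (#|S| <= w)%N.
  by have [_ _ _ anti] := un; apply: anti => x y xS yS; apply: Smax => //; apply: (subsetP Su).
have weak k : (k <= k1 + k2 + (k0 + K'))%N ->
    pr R r (fun g => (g u + k <= g b)%N) <= m.+1%:R * kp ->
    pr R r (fun g => (g u + (k1 + k2 + (k0 + K')) <= g b)%N) <= m.+1%:R * kp.
  move=> kk; apply: le_trans; apply: pr_mono => g _; apply: leq_trans.
  by rewrite leq_add2l.
have kpm : kp <= m.+1%:R * kp by rewrite ler_peMl ?(ltW kp0) // ler1n.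
have cutb : c <= pr R r (cut R r b) := cut_prob eps0 un eps1 b.
have uub : u \in up R r b by rewrite -dn_up.
(* If fewer than [K.+1] places remain after [b], then [u] itself is close to [b] whenever [b] is
   cut. *)
have [small|big] := ltnP (#|dn R r b| + K.+1) #|T|; last first.
  apply: (weak k1); first by clear; lia.
  apply: le_trans kpm; apply: (H1 T r un b u u) => //.
    by rewrite inE eqxx.
  apply: le_trans cutb _; apply: pr_mono => g gL gb.
  have := cut_pos eps0 un gL gb; have /cutP[_ /(_ u uub)] := gb.
  by have := ltn_ord (g u); move: big; clear => /=; lia.
pose E (g : {ffun T -> 'I_#|T|}) := cut R r b g && ~~ [exists b' in S, (g b + K.+1 <= g b')%N].
have PE : c / 2 <= pr R r E.
  apply: le_trans (prD_ge R (un_le0 un) _ _).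
  have h1 := pr_bigU Sb.
  have h2 : #|S|%:R * ((w.+1 - m.+1)%:R * kp) <= (w.+1 * w.+1)%:R * kp.
    by rewrite mulrA -natrM ler_wpM2r ?(ltW kp0) // ler_nat; apply: leq_mul; move: Sw'; clear; lia.
  have h3 : (2 * w.+1 * w.+1)%:R * kp = 2 * ((w.+1 * w.+1)%:R * kp).
    by rewrite -mulnA natrM mulrA.
  move: (pr R r (fun g => [exists i in S, (g b + K.+1 <= g i)%N])) h1 h2 => p h1 h2; lra.
have [v Hv] := follower_exists eps0 un c20 (fun g h => proj1 (andP h)) small PE.
rewrite -/q -/eta in Hv.
have bv : eta <= pr R r (fun g => (g b < g v)%N && (g v <= g b + K.+1)%N).
  by apply: le_trans Hv _; apply: pr_mono => g _ /andP[_ /eqP ->]; clear; lia.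
have [vu|vu] := boolP (v \in dn R r u); last first.
  by apply: (weak k2); [by clear; lia|apply: le_trans kpm; apply: (H2 T r un b u v)].
have [b1 [b1u vb1 b1max]] := max_above (un_irr un) (un_tr un) vu.
have [g0 g0L /andP[/andP[g0c g0S] /eqP g0v]] := pr_gt0_ex (lt_le_trans eta0 Hv).
have le_vb1 g : g \in le_set r -> (g v <= g b1)%N.
  by move=> /le_setP[go _]; case/orP: vb1 => [/eqP <- //|/go/ltnW].
(* In an extension [g0] of the event, [b1] is at least as high as [v], thus at least [K.+1] above
   [b], where no element of [S] lies. *)
have b1S : b1 \notin S.
  apply: contra g0S => b1S; apply/existsP; exists b1; rewrite b1S /= -g0v.
  exact: le_vb1.
have back : pr R r (fun g => (g b1 + K' <= g b)%N) <= kp.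
  apply: le_trans (H3 T r v b _).
    by apply: pr_mono => g gL; apply: leq_trans; rewrite leq_add2r le_vb1.
  by apply: le_trans bv _; apply: pr_mono => g _; clear; lia.
have Hb1 : pr R r (fun g => (g u + k0 <= g b1)%N) <= m%:R * kp.
  apply: (H0 T r un u (b1 |: S) b1).
  - by apply/subsetP => s /setU1P[-> //|]; apply: (subsetP Su).
  - by move=> s t /setU1P[->|sS] tu; [apply: b1max|apply: Smax].
  - exact: setU11.
  - by rewrite cardsU1 b1S; move: Sw; clear; lia.
  move=> b' /setU1P[->|b'S].
    apply: (@le_trans _ _ 0); last by rewrite mulr_ge0 ?ler0n ?(ltW kp0).
    rewrite /pr (_ : [set _ in _ | _] = set0) ?cards0 ?mul0r //.
    by apply/setP => g; rewrite in_set in_set0; apply/negP; clear; lia.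
  (* Being far above [b1] means being far above [b], unless [b] is itself far above [b1]; this turns
     [K] into [K + K'] and adds one [kp]. *)
  apply: (@le_trans _ _ (pr R r (fun g => (g b + K.+1 <= g b')%N || (g b1 + K' <= g b)%N))).
    by apply: pr_mono => g _; clear; lia.
  apply: le_trans (prU _ _ _ _) _; have := Sb b' b'S => h1.
  rewrite subSS in h1; rewrite subSn; last by move: mw; clear; lia.
  by rewrite -natr1 mulrDl mul1r; apply: lerD.
apply: (weak (k0 + K')%N); first by clear; lia.
apply: (@le_trans _ _ (pr R r (fun g => (g u + k0 <= g b1)%N || (g b1 + K' <= g b)%N))).
  by apply: pr_mono => g _; clear; lia.
apply: le_trans (prU _ _ _ _) _.
by rewrite -natr1 mulrDl mul1r; apply: lerD.
Qed.

(** Replace [z] by a maximal element [b] of [dn u] above it and start from [S = [set b]], [m = w],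
    [K = 0]. *)
Lemma late_tail (R : realType) (eps : R) (w : nat) (dl : R) :
  0 < eps -> eps <= 1 / 2 -> 0 < dl ->
  exists k : nat, forall (T : finType) (r : rel T), unbalanced eps w r ->
    forall z u, z \in dn R r u -> pr R r (fun g => (g u + k <= g z)%N) <= dl.
Proof.
move=> eps0 eps1 dl0.
have c0 : 0 < cut_const eps w by apply: cut_const_gt0.
pose N := (2 * w.+1 * w.+1)%N; have N0 : 0 < N%:R :> R by rewrite ltr0n.
pose kp := Num.min (cut_const eps w / N%:R) (dl / w.+1%:R).
have kp0 : 0 < kp by rewrite lt_min !divr_gt0 // ltr0n.
have kpc : N%:R * kp <= cut_const eps w.
  by rewrite mulrC -ler_pdivlMr // ge_min lexx.
have kpd : w%:R * kp <= dl.
  have h : w.+1%:R * kp <= dl by rewrite mulrC -ler_pdivlMr ?ltr0n // ge_min lexx orbT.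
  apply: le_trans h; rewrite ler_wpM2r ?(ltW kp0) // ler_nat; lia.
have [k Hk] := late_maximal_tail eps0 eps1 kp0 kpc 0 (leqnn w).
exists k => T r un z u zu.
have [b [bu zb bmax]] := max_above (un_irr un) (un_tr un) zu.
apply: le_trans kpd; apply: (@le_trans _ _ (pr R r (fun g => (g u + k <= g b)%N))).
  apply: pr_mono => g /le_setP[go _] h; apply: leq_trans h _.
  by case/orP: zb => [/eqP -> //|/go/ltnW].
apply: (Hk T r un u [set b] b).
- by apply/subsetP => s /set1P ->.
- by move=> s t /set1P ->; apply: bmax.
- exact: set11.
- by rewrite cards1; clear; lia.
move=> b' /set1P ->; apply: (@le_trans _ _ 0); last by rewrite mulr_ge0 ?ler0n ?(ltW kp0).
rewrite /pr (_ : [set _ in _ | _] = set0) ?cards0 ?mul0r //.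
by apply/setP => g; rewrite in_set in_set0; apply/negP; clear; lia.
Qed.

(** A version of [cut] with tolerance [k], which can be made to hold with probability close to 1 and
    not merely bounded below. *)
Definition steady (R : realType) (T : finType) (r : rel T) (y : T) (k : nat)
    (g : {ffun T -> 'I_#|T|}) : bool :=
  [forall z in dn R r y, (g z < g y + k)%N] && [forall u in up R r y, (g y < g u + k)%N].

Lemma steadyP (R : realType) (T : finType) (r : rel T) (y : T) k (g : {ffun T -> 'I_#|T|}) :
  reflect ((forall z, z \in dn R r y -> (g z < g y + k)%N) /\
           (forall u, u \in up R r y -> (g y < g u + k)%N)) (steady R r y k g).
Proof.
by apply: (iffP andP) => -[H1 H2]; split; exact/forall_inP.
Qed.

Lemma steady_prob (R : realType) (eps : R) (w : nat) (dl : R) :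
  0 < eps -> eps <= 1 / 2 -> 0 < dl ->
  exists k : nat, forall (T : finType) (r : rel T), unbalanced eps w r ->
    forall y, pr R r (fun g => ~~ steady R r y k g) <= dl.
Proof.
move=> eps0 eps1 dl0; pose N := (2 * w.+1)%N.
have N0 : 0 < N%:R :> R by rewrite ltr0n.
have th0 : 0 < dl / N%:R by rewrite divr_gt0.
have [k Hk] := late_tail w eps0 eps1 th0; exists k => T r un y.
have [D Dw [Ds Dmax]] := maxset_dn eps0 un (dn R r y).
have [U Uw [Us Umin]] := minset_up eps0 un (up R r y).
apply: (@le_trans _ _ (pr R r (fun g => [exists z in D, (g y + k <= g z)%N] ||
    [exists u in U, (g u + k <= g y)%N]))).
  apply: pr_mono => g /le_setP[go _]; rewrite negb_and => /orP[|]; rewrite negb_forall_in.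
    case/exists_inP => z zy; rewrite -leqNgt => h; apply/orP; left.
    have [m mD zm] := Dmax z zy; apply/exists_inP; exists m => //; apply: leq_trans h _.
    by case/orP: zm => [/eqP -> //|/go/ltnW].
  case/exists_inP => z zy; rewrite -leqNgt => h; apply/orP; right.
  have [m mD zm] := Umin z zy; apply/exists_inP; exists m => //; apply: leq_trans h.
  by rewrite leq_add2r; case/orP: zm => [/eqP -> //|/go/ltnW].
apply: le_trans (prU _ _ _ _) _.
have h1 : pr R r (fun g => [exists z in D, (g y + k <= g z)%N]) <= #|D|%:R * (dl / N%:R).
  by apply: pr_bigU => z zD; apply: Hk un _ _ (subsetP Ds z zD).
(* For [u] in [up y], the element [y] is in [dn u], so the same tail bound applies with the roles
   exchanged. *)
have h2 : pr R r (fun g => [exists u in U, (g u + k <= g y)%N]) <= #|U|%:R * (dl / N%:R).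
  by apply: pr_bigU => z zD; apply: Hk un _ _ _; rewrite dn_up (subsetP Us z zD).
apply: le_trans (lerD h1 h2) _; rewrite -mulrDl -natrD mulrA ler_pdivrMr // mulrC.
by rewrite ler_pM2l // ler_nat /N; move: Dw Uw; clear; lia.
Qed.

(** * Lowering one element of a linear extension *)

Section Relabel.
Variable (T : finType).

Definition relabel (s : 'I_#|T| -> 'I_#|T|) (g : {ffun T -> 'I_#|T|}) : {ffun T -> 'I_#|T|} :=
  [ffun e => s (g e)].

Lemma relabel_inj s : injective s -> injective (relabel s).
Proof.
by move=> si g h /ffunP E; apply/ffunP => e; apply: si; have := E e; rewrite !ffunE.
Qed.
End Relabel.

Section Lower.
Variables (n t s : nat).
Hypotheses (tn : (t < n)%N) (st : (s <= t)%N).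

(* Moves position [t] down to [t - s]. *)
Definition lower_fun (i : nat) : nat :=
  if i == t then (t - s)%N else if (t - s <= i < t)%N then i.+1 else i.

Lemma lower_bound i : (i < n)%N -> (lower_fun i < n)%N.
Proof. by rewrite /lower_fun; case: eqP => [_|_]; [|case: ifP]; move: tn st; clear; lia. Qed.

Definition lower (i : 'I_n) : 'I_n := Ordinal (lower_bound (ltn_ord i)).

Lemma lower_inj : injective lower.
Proof.
move=> i j /(congr1 val) /=; rewrite /lower_fun => E; apply: val_inj => /=.
move: st E; clear; case: eqP => [->|]; case: eqP => [->|]; do ?case: ifP; lia.
Qed.
End Lower.

Section LowerExtension.
Variables (T : finType) (r : rel T).

Lemma lower_le_set (x : T) (t s : nat) (tn : (t < #|T|)%N) (st : (s <= t)%N) g :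
  g \in le_set r -> g x = t :> nat -> (forall z, r z x -> (g z < t - s)%N) ->
  relabel (lower tn st) g \in le_set r.
Proof.
move=> /le_setP[go gi] gx Hz; apply/le_setP; split; last first.
  move=> a b; rewrite !ffunE => /lower_inj; exact: gi.
move=> a b rab; rewrite !ffunE /= /lower_fun; have gab := go a b rab.
have [bx|bx] := eqVneq b x.
  subst b; have := Hz a rab; rewrite gx eqxx; move: gab; rewrite gx => h1 h2.
  by case: eqP => [E|_]; [|case: ifP]; move: h1 h2; rewrite ?E; clear => /=; lia.
have gbx : (g b : nat) <> t by move=> E; case/eqP: bx; apply: gi; apply: val_inj; rewrite /= E gx.
move: gab gbx st; clear => /=; case: eqP => [->|_]; case: eqP => [->|_] //; do ?case: ifP; lia.
Qed.

End LowerExtension.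

(** When [x] is cut and [c 0] is steady, the predecessors of [x] lie below [c 0] up to [k] places,
    while the chain separates [c 0] from [x] by more than [k + S] places. So [x] can be lowered by
    every [s <= S], and each of these [S.+1] positions has probability at least [cc / 2], too much
    since [S > 2 / cc]. *)
Lemma isolated_contra (R : realType) (eps : R) (w : nat) :
  0 < eps -> eps <= 1 / 2 ->
  exists s0 : nat, forall (T : finType) (r : rel T), unbalanced eps w r ->
    forall (x : T) (c : nat -> T),
      (forall i j, (i < j <= s0)%N -> r (c i) (c j)) ->
      (forall i, (i <= s0)%N -> c i \in dn R r x) ->
      (forall z, r z x -> z \in dn R r (c 0%N)) -> False.
Proof.
move=> eps0 eps1; have c0 := cut_const_gt0 w eps0; set cc := cut_const eps w in c0.
have dl0 : 0 < cc / 2 by rewrite divr_gt0.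
have [k Hk] := steady_prob w eps0 eps1 dl0.
pose S := Num.bound (2 / cc).
exists (k + S).+1 => T r un x c chain cx below.
have le0 := un_le0 un.
pose E (g : {ffun T -> 'I_#|T|}) := cut R r x g && steady R r (c 0%N) k g.
have PE : cc / 2 <= pr R r E.
  have h1 := cut_prob eps0 un eps1 x; rewrite -/cc in h1.
  have h2 := prD_ge R le0 (cut R r x) (fun g => ~~ steady R r (c 0%N) k g).
  have h3 := Hk T r un (c 0%N).
  apply: (@le_trans _ _ (pr R r (fun g => cut R r x g && ~~ ~~ steady R r (c 0%N) k g))).
    by lra.
  by apply: pr_mono => g _; rewrite negbK.
set t := #|dn R r x|.
have Eprop g : g \in le_set r -> E g ->
    g x = t :> nat /\ forall z s, (s <= S)%N -> r z x -> (g z < t - s)%N.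
  move=> gL /andP[gc gs]; have gx := cut_pos eps0 un gL gc; split=> // z s sS rzx.
  have /le_setP[go _] := gL; have /steadyP[Hs _] := gs; have /cutP[Hc _] := gc.
  have climb i : (i <= (k + S).+1)%N -> (g (c 0%N) + i <= g (c i))%N.
    elim: i => [|i IH] iS; first by rewrite addn0.
    rewrite addnS; apply: leq_ltn_trans (IH (ltnW iS)) _; apply: go; apply: chain.
    by rewrite ltnSn.
  have h1 := Hs z (below z rzx); have h2 := climb _ (leqnn _).
  have h3 := Hc _ (cx _ (leqnn _)); rewrite gx -/t in h3.
  by move: h1 h2 h3 sS; clear => /=; lia.
have [g0 g0L g0E] := pr_gt0_ex (lt_le_trans dl0 PE).
have [g0x g0z] := Eprop g0 g0L g0E.
have tn : (t < #|T|)%N by rewrite -g0x.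
have St : (S <= t)%N.
  have /andP[/cutP[Hc _] _] := g0E; have /le_setP[go _] := g0L.
  have climb i : (i <= (k + S).+1)%N -> (i <= g0 (c i))%N.
    elim: i => [|i IH] iS //; apply: leq_ltn_trans (IH (ltnW iS)) _; apply: go; apply: chain.
    by rewrite ltnSn.
  have := climb _ (leqnn _); have := Hc _ (cx _ (leqnn _)); rewrite g0x; clear => /=; lia.
have := @pr_disjoint_sum R T r S (fun s g => g x == (t - s)%N :> nat) (cc / 2).
move=> /(_ _ _)-H; have {H} : S.+1%:R * (cc / 2) <= 1.
  apply: H.
    by move=> s s' g ss /eqP -> /eqP; move: ss St; clear; lia.
  move=> s sS; apply: le_trans PE _.
  rewrite /pr ler_wpM2r ?invr_ge0 ?ler0n // ler_nat.
  have st : (s <= t)%N by apply: leq_trans St.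
  (* Lowering by [s] is injective and sends the event [E] into the event that [x] is at position
     [t - s]. *)
  rewrite -(card_imset _ (relabel_inj (lower_inj (tn := tn) (st := st)))).
  apply: subset_leq_card; apply/subsetP => _ /imsetP[g /setIdP[gL gE] ->].
  have [gx gz] := Eprop g gL gE; apply/setIdP; split.
    by apply: (lower_le_set (x := x)) => // z; apply: gz.
  by rewrite ffunE /= /lower_fun gx eqxx.
have Sb : 2 / cc < S%:R by apply: archi_boundP; rewrite divr_ge0 // ltW.
rewrite -natr1 mulrDl mul1r; move: Sb; rewrite ltr_pdivrMr // => Sb.
lra.
Qed.

(** * Growth of the sets of predecessors along a chain *)

(** If no such [a] exists, a minimal element [x'] of [up y], with [y = c (i + s0)], among those
    below or equal to [x] contradicts [isolated_contra]: its predecessors are in [dn y] by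
    minimality, hence in [dn (c i)] by assumption. *)
Lemma below_density (R : realType) (eps : R) (w : nat) :
  0 < eps -> eps <= 1 / 2 ->
  exists s0 : nat, forall (T : finType) (r : rel T), unbalanced eps w r ->
    forall (x : T) (c : nat -> T) m,
      (forall i j, (i < j <= m)%N -> r (c i) (c j)) ->
      (forall i, (i <= m)%N -> c i \in dn R r x) ->
      (forall i, (i <= m)%N -> ~~ r (c i) x) ->
      forall i, (i + s0 <= m)%N ->
        exists a, [/\ (a == x) || r a x, a \in dn R r (c (i + s0)%N) & a \notin dn R r (c i)].
Proof.
move=> eps0 eps1; have [s0 Hs] := isolated_contra w eps0 eps1; exists s0.
move=> T r un x c m chain cx cnx i im.
have tr := un_tr un; have irr := un_irr un.
case: (pickP (fun a => [&& (a == x) || r a x, a \in dn R r (c (i + s0)%N) & a \notin dn R r (c i)])).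
  by move=> a /and3P[]; exists a.
move=> no; exfalso; set y := c (i + s0)%N in no.
pose A := [set z | ((z == x) || r z x) && (z \in up R r y)].
have xA : x \in A by rewrite in_set eqxx -dn_up cx.
have tr' : transitive (fun a b => r b a) by move=> a b d h1 h2; apply: tr h2 h1.
have [x' [/setIdP[x'x yx'] _ x'min]] := @max_above _ (fun a b => r b a) irr tr' A x xA.
apply: (Hs T r un x' (fun j => c (i + j)%N)).
- move=> j1 j2 /andP[j12 j2s]; apply: chain; rewrite ltn_add2l j12.
  by apply: leq_trans im; rewrite leq_add2l.
- move=> j js; move: yx'; rewrite -dn_up => yx'.
  have [->|js'] := eqVneq j s0; first exact: yx'.
  apply: (dn_down eps0 un _ yx'); apply: chain; rewrite ltn_add2l im andbT.
  by rewrite ltn_neqAle js' js.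
rewrite addn0 => z zx'.
have zx : (z == x) || r z x.
  by case/orP: x'x => [/eqP <-|h]; rewrite ?zx' ?(tr _ _ _ zx' h) orbT.
have zy : z != y.
  apply: contraTneq zx => ->; rewrite negb_or (cnx _ im) andbT.
  by have := cx _ im; rewrite inE => /andP[].
have zA : z \notin A by apply/negP => /x'min; rewrite zx'.
have zup : z \notin up R r y by apply: contra zA => h; rewrite in_set zx h.
have zdn : z \in dn R r y by have := dnU eps0 un zy; rewrite (negPf zup) orbF.
by have := no z; rewrite zx zdn /= => /negbFE.
Qed.

(** * Moving elements of a down-set past a fixed element *)

Section Moves.
Variables (T : finType) (r : rel T) (X : {set T}).
Hypothesis Xdown : forall z x, x \in X -> r z x -> z \in X.
Let n := #|T|.
Implicit Types (g : {ffun T -> 'I_#|T|}).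

Definition occupied g i : bool := [exists z in X, g z == i :> nat].

Definition swap_pos i k : nat := if k == i then i.+1 else if k == i.+1 then i else k.

(* Moves the letter at position [i.+1] to position [i] in the word recording
   which positions are occupied by [X]: a swap when position [i] is not
   occupied by [X], and nothing otherwise. *)
Definition step i g : {ffun T -> 'I_#|T|} :=
  if occupied g i then g else [ffun e => insubd (g e) (swap_pos i (g e))].

Lemma swap_posK i : involutive (swap_pos i).
Proof. by move=> k; rewrite /swap_pos; do ?case: eqP; lia. Qed.

Lemma occupiedP g i : reflect (exists2 z, z \in X & g z = i :> nat) (occupied g i).
Proof. by apply: (iffP exists_inP) => -[z zX /eqP]; exists z => //; apply/eqP. Qed.

Lemma swap_val i g e : (i.+1 < #|T|)%N ->
  (insubd (g e) (swap_pos i (g e)) : 'I_#|T|) = swap_pos i (g e) :> nat.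
Proof.
move=> iT; rewrite val_insubd; suff -> : (swap_pos i (g e) < #|T|)%N by [].
have := ltn_ord (g e); move: iT; rewrite /swap_pos; clear => /=; do ?case: eqP; lia.
Qed.

Lemma occupied_bound g i : occupied g i -> (i < #|T|)%N.
Proof. by case/occupiedP => z _ <-. Qed.

Lemma step_notin i g e : injective g -> occupied g i.+1 -> e \notin X ->
  step i g e = (g e + (g e == i :> nat))%N :> nat.
Proof.
move=> gi o1 eX; rewrite /step; case: ifP => [/occupiedP[z zX gz]|_].
  suff -> : (g e == i :> nat) = false by rewrite addn0.
  by apply/eqP => ge; case/negP: eX; rewrite (_ : e = z) //; apply: gi; apply: val_inj; rewrite /= ge.
rewrite ffunE swap_val; last exact: occupied_bound o1.
have {o1} /occupiedP[z zX gz] := o1; rewrite /swap_pos; case: eqP => [->|ne]; first by rewrite addn1.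
case: eqP => [ge|]; last by rewrite addn0.
by case/negP: eX; rewrite (_ : e = z) //; apply: gi; apply: val_inj; rewrite /= ge.
Qed.

(** A swap is legal since the element at [i] is outside the down-set [X] and so cannot be below the
    element of [X] at [i.+1]. *)
Lemma step_le_set i g : g \in le_set r -> occupied g i.+1 ->
  step i g \in le_set r /\ occupied (step i g) i.
Proof.
move=> gL o1; rewrite /step; case: ifP => // o0.
have /le_setP[go gi] := gL; have iT := occupied_bound o1.
have {o1} /occupiedP[z zX gz] := o1.
split; last first.
  apply/occupiedP; exists z => //; rewrite ffunE swap_val // gz /swap_pos eqxx.
  by case: eqP => //; lia.
apply/le_setP; split; last first.
  move=> a b /(congr1 val); rewrite !ffunE /= !swap_val // => /(can_inj (swap_posK i)) E.
  by apply: gi; apply: val_inj.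
move=> a b rab; rewrite !ffunE !swap_val //; have gab := go a b rab.
have bad : ~ (g a = i :> nat /\ g b = i.+1 :> nat).
  case=> ga gb; have bz : b = z by apply: gi; apply: val_inj; rewrite /= gb gz.
  case/negP: (negbT o0); apply/occupiedP; exists a => //; apply: Xdown rab.
  by rewrite bz.
move: gab bad; rewrite /swap_pos; clear => /=; do ?case: eqP; lia.
Qed.

(** Whether a swap took place can be read off the result: position [i.+1] remains occupied by [X]
    exactly when nothing moved. *)
Lemma step_inj i g1 g2 : injective g1 -> injective g2 ->
  occupied g1 i.+1 -> occupied g2 i.+1 -> step i g1 = step i g2 -> g1 = g2.
Proof.
move=> i1 i2 o1 o2; have iT := occupied_bound o1.
have mixed (h1 h2 : {ffun T -> 'I_#|T|}) : injective h1 -> injective h2 -> occupied h1 i.+1 -> occupied h1 i ->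
    ~~ occupied h2 i -> h1 = [ffun e => insubd (h2 e) (swap_pos i (h2 e))] -> False.
  move=> j1 j2 p1 p0 q0 E; have /occupiedP[z zX hz] := p1.
  case/negP: q0; apply/occupiedP; exists z => //.
  have : h1 z = swap_pos i (h2 z) :> nat by rewrite E ffunE swap_val.
  by rewrite hz => /(congr1 (swap_pos i)); rewrite swap_posK /swap_pos eqxx => <-; case: eqP => //; lia.
rewrite /step; case: ifP => [p1|/negbT p1]; case: ifP => [p2|/negbT p2] //.
- by move=> E; case: (mixed g1 g2).
- by move=> E; case: (mixed g2 g1).
move/ffunP => E; apply/ffunP => e; have := congr1 val (E e); rewrite !ffunE /= !swap_val //.
by move/(can_inj (swap_posK i)) => h; apply: val_inj.
Qed.

(** Carries the letter at position [l + d] of the occupancy word down to [l]; which element of [X]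
    ends up at [l] is immaterial. *)
Fixpoint move_down l d g : {ffun T -> 'I_#|T|} :=
  if d is d'.+1 then move_down l d' (step (l + d') g) else g.

Lemma move_down_spec l d g : g \in le_set r -> occupied g (l + d) ->
  [/\ move_down l d g \in le_set r, occupied (move_down l d g) l &
      forall e, e \notin X -> move_down l d g e = (g e + (l <= g e < l + d))%N :> nat].
Proof.
elim: d g => [|d IH] g gL; first by rewrite addn0 => o; split=> // e _ /=; rewrite ltnNge andbN addn0.
rewrite addnS => o; have [sL so] := step_le_set gL o; have [h1 h2 h3] := IH _ sL so.
split=> // e eX; have /le_setP[_ gi] := gL.
rewrite /= h3 // (step_notin gi o eX); move: (nat_of_ord (g e)) => k; clear; case: (k =P (l + d)%N) => [->|]; lia.
Qed.

Lemma move_down_inj l d g1 g2 : g1 \in le_set r -> g2 \in le_set r ->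
  occupied g1 (l + d) -> occupied g2 (l + d) -> move_down l d g1 = move_down l d g2 -> g1 = g2.
Proof.
elim: d g1 g2 => [|d IH] g1 g2 L1 L2 //=; rewrite addnS => o1 o2 E.
have [s1 p1] := step_le_set L1 o1; have [s2 p2] := step_le_set L2 o2.
have /le_setP[_ i1] := L1; have /le_setP[_ i2] := L2.
exact: (step_inj i1 i2 o1 o2 (IH _ _ s1 s2 p1 p2 E)).
Qed.

End Moves.

Local Open Scope nat_scope.

Lemma card_dep_pairs_le (X Y : finType) (S : {set X}) (Q : X -> {set Y}) k :
  (forall x, x \in S -> #|Q x| <= k) ->
  #|[set p : X * Y | (p.1 \in S) && (p.2 \in Q p.1)]| <= #|S| * k.
Proof.
move=> H; rewrite -sum_nat_const -[X in X <= _]sum1_card.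
rewrite (eq_bigl (fun p : X * Y => (p.1 \in S) && (p.2 \in Q p.1))) => [|p]; last by rewrite inE.
rewrite -(pair_big_dep (mem S) (fun x y => y \in Q x) (fun _ _ => 1)) /=.
by apply: leq_sum => x xS; rewrite sum1_card H.
Qed.

Section Transition.
Variables (T : finType) (r : rel T) (X : {set T}) (y1 y y2 : T).
Hypothesis Xdown : forall z x, x \in X -> r z x -> z \in X.
Hypotheses (X1 : y1 \notin X) (X0 : y \notin X) (X2 : y2 \notin X).
Hypotheses (r1 : r y1 y) (r2 : r y y2).
Implicit Types (g : {ffun T -> 'I_#|T|}).

Definition between g a b : {set T} := [set z in X | g a < g z < g b].

Lemma card_between_add g a b : injective g -> g a < g b ->
  (#|between g a b| + #|[set z in ~: X | g a < g z < g b]|).+1 = g b - g a.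
Proof.
move=> gi ab; have := card_positions (fun q : 'I_#|T| => (g a).+1 <= q < g b) gi.
rewrite card_ord_interval ?(ltnW (ltn_ord _)) // => E.
have -> : g b - g a = (g b - (g a).+1).+1 by lia.
rewrite -E -(cardsID X [set z | g a < g z < g b]); congr S; congr (_ + _).
  by apply: eq_card => z; rewrite !in_set andbC.
by apply: eq_card => z; rewrite !in_set.
Qed.

(** The inequalities are the bounds on the numbers of possible source and target positions that the
    counting of moves uses. *)
Definition window p a b n1 n2 : {set {ffun T -> 'I_#|T|}} :=
  [set g in le_set r | [&& g y == p :> nat, g y1 <= a, g y2 <= b,
     #|between g y1 y| <= n1 & n2 <= #|between g y y2|]].

Lemma move_down_window p a b n1 n2 g l k : g \in window p a b n1 n2 ->
  g y1 < l <= g y -> g y < k < g y2 -> occupied X g k ->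
  let g' := move_down X l (k - l) g in
  [/\ g' \in window p.+1 a b n1.+1 n2.-1, occupied X g' l, g' y1 < l < g' y & g' y <= k < g' y2].
Proof.
move=> /setIdP[gL /and5P[/eqP gy ga gb gn1 gn2]] /andP[l1 l2] /andP[k1 k2] ok g'.
have lk : l + (k - l) = k by lia.
have := @move_down_spec T r X Xdown l (k - l) g gL; rewrite lk => /(_ ok) [g'L ol g'e].
rewrite -/g' in g'L ol g'e.
have e1 : g' y1 = g y1 :> nat by rewrite g'e //; move: l1; clear => /=; lia.
have e0 : g' y = (g y).+1 :> nat by rewrite g'e //; move: l2 k1; clear => /=; lia.
have e2 : g' y2 = g y2 :> nat by rewrite g'e //; move: k2; clear => /=; lia.
have /le_setP[go gi] := gL; have /le_setP[g'o g'i] := g'L.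
have lt_notin e f : e \notin X -> f \notin X -> g e < g f -> g' e < g' f.
  move=> eX fX ef; rewrite ltn_neqAle; apply/andP; split.
    by apply: contraTneq ef => /val_inj/g'i ->; rewrite ltnn.
  by rewrite !g'e //; move: ef; clear => /=; lia.
have lt_notin_eq e f : e \notin X -> f \notin X -> (g' e < g' f) = (g e < g f).
  move=> eX fX; apply/idP/idP; last exact: lt_notin.
  case: (ltngtP (g e) (g f)) => // [/(lt_notin _ _ fX eX) h|/val_inj/gi ->]; last by rewrite ltnn.
  by rewrite ltnNge ltnW.
have same u v : u \notin X -> v \notin X ->
    #|[set z in ~: X | g' u < g' z < g' v]| = #|[set z in ~: X | g u < g z < g v]|.
  move=> uX vX; apply: eq_card => z; rewrite !in_set; case zX : (z \in X) => //=.
  by rewrite !lt_notin_eq ?zX.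
have c1 := card_between_add gi (go _ _ r1); have c1' := card_between_add g'i (g'o _ _ r1).
have c2 := card_between_add gi (go _ _ r2); have c2' := card_between_add g'i (g'o _ _ r2).
rewrite same // in c1'; rewrite same // in c2'.
rewrite e1 e0 in c1'; rewrite e2 e0 in c2'.
have h1 := go _ _ r1; have h2 := go _ _ r2.
have d1 : #|between g' y1 y| = #|between g y1 y|.+1 by move: c1 c1' h1; clear => /=; lia.
have d2 : #|between g' y y2| = #|between g y y2|.-1 by move: c2 c2' h2; clear => /=; lia.
split=> //; rewrite ?e1 ?e0 ?e2.
- by apply/setIdP; split=> //; rewrite e0 e1 e2 gy eqxx ga gb d1 d2 /= ltnS gn1; move: gn2; clear; lia.
- by rewrite l1 ltnS.
by rewrite k1.
Qed.

Lemma card_occupied_between g a b : injective g ->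
  #|[set k : 'I_#|T| | occupied X g k && (g a < k < g b)]| = #|between g a b|.
Proof.
move=> gi; rewrite -(card_imset [set z in X | g a < g z < g b] gi); apply: eq_card => k; rewrite in_set.
apply/andP/imsetP => [[/occupiedP[z zX gz] kk]|[z /setIdP[zX zz] ->]].
  by exists z; [apply/setIdP; rewrite gz|apply: val_inj].
by split=> //; apply/occupiedP; exists z.
Qed.

(* [F] carries the element of [X] at position [k] down to position [l], and keeps
   [(l, k)] to make the move invertible. *)
Lemma window_transition p a b n1 n2 :
  #|window p a b n1 n2| * ((p - a) * n2) <=
  #|window p.+1 a b n1.+1 n2.-1| * (n1.+1 * (b - p.+1)).
Proof.
pose P' : finType := ('I_#|T| * 'I_#|T|)%type.
pose Q g : {set P'} := setX [set l : 'I_#|T| | (g y1).+1 <= l < (g y).+1]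
                       [set k : 'I_#|T| | occupied X g k && (g y < k < g y2)].
pose Q' g : {set P'} := setX [set l : 'I_#|T| | occupied X g l && (g y1 < l < g y)]
                        [set k : 'I_#|T| | g y <= k < g y2].
pose F g (q : P') := (move_down X q.1 (q.2 - q.1) g, q).
pose W := [set q : {ffun T -> 'I_#|T|} * P' | (q.1 \in window p.+1 a b n1.+1 n2.-1) && (q.2 \in Q' q.1)].
have winL p' a' b' m1 m2 g : g \in window p' a' b' m1 m2 -> g \in le_set r by case/setIdP.
(* After the move, [l] is one of at most [n1.+1] positions of [X] between [y1] and [y], and [k] one
   of at most [b - p.+1] positions from [y] up to [y2]. Before it, there are at least [p - a]
   choices of [l] and [n2] of [k]. *)
apply: (@leq_trans #|W|); last first.
  apply: card_dep_pairs_le => g gw; have /le_setP[_ gi] := winL _ _ _ _ _ _ gw.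
  move: gw => /setIdP[_ /and5P[/eqP gy ga gb gn1 gn2]].
  rewrite cardsX card_occupied_between // card_ord_interval ?(ltnW (ltn_ord _)) //.
  by apply: leq_mul => //; rewrite gy leq_sub2r.
apply: (@double_count _ _ _ _ Q F).
- move=> g gw; have /le_setP[_ gi] := winL _ _ _ _ _ _ gw.
  move: gw => /setIdP[_ /and5P[/eqP gy ga gb gn1 gn2]].
  rewrite cardsX card_occupied_between // card_ord_interval ?ltn_ord //.
  by apply: leq_mul => //; rewrite subSS gy leq_sub2l.
- move=> g [l k] gw /setXP[hl hk]; rewrite in_set in hl; rewrite in_set in hk.
  move: hl hk => /=; rewrite ltnS => hl /andP[ok hk].
  have [h1 h2 h3 h4] := move_down_window gw hl hk ok.
  rewrite in_set /=; apply/andP; split; first exact: h1.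
  by rewrite in_setX !in_set /= h2 h3 h4.
move=> g [l k] g' [l' k'] gw h gw' h' [] E El Ek.
subst l' k'; split=> //; move: h h' => /setXP[hl hk] /setXP[_ hk'].
rewrite in_set in hl; rewrite in_set in hk; rewrite in_set in hk'.
move: hl hk hk' => /= hl /andP[ok hk] /andP[ok' hk'].
have lk : l + (k - l) = k by move: hl hk; clear => /=; lia.
apply: (@move_down_inj T r X Xdown l (k - l)); rewrite ?lk //.
  exact: winL gw.
exact: winL gw'.
Qed.

End Transition.

Local Open Scope ring_scope.

(** * Positions and counts in steady linear extensions *)

Section SteadyCounts.
Variables (R : realType) (eps : R) (w : nat) (T : finType) (r : rel T) (g : {ffun T -> 'I_#|T|}).
Hypothesis eps0 : 0 < eps.
Hypothesis un : unbalanced eps w r.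
Hypothesis gL : g \in le_set r.
Let gi : injective g. Proof. by case/le_setP: gL. Qed.

Lemma card_pos_interval a b : (#|[set z | (a <= g z < b)%N]| <= b - a)%N.
Proof.
rewrite (card_positions (fun q : 'I_#|T| => (a <= q < b)%N) gi).
have [bT|Tb] := leqP b #|T|; first by rewrite card_ord_interval.
apply: (@leq_trans (#|T| - a)%N); last by rewrite leq_sub2r // ltnW.
rewrite -(@card_ord_interval #|T| a #|T|) //; apply: subset_leq_card; apply/subsetP => q.
by rewrite !in_set => /andP[->]; rewrite ltn_ord.
Qed.

(** An element before [y] but outside [dn y] is in [up y], hence among the [k] places just before
    [y]. *)
Lemma steady_pos y k : steady R r y k g -> (g y <= #|dn R r y| + k)%N.
Proof.
move=> /steadyP[_ Hu].
have := card_positions (fun q : 'I_#|T| => (0 <= q < g y)%N) gi.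
rewrite card_ord_interval ?subn0 ?(ltnW (ltn_ord _)) // => <-.
rewrite -(cardsID (dn R r y)); apply: leq_add; first by apply: subset_leq_card; apply: subsetIr.
apply: (@leq_trans #|[set z | (g y - k <= g z < g y)%N]|).
  apply: subset_leq_card; apply/subsetP => z /setDP[zy zd]; rewrite in_set /= in zy; rewrite in_set.
  have zy' : z != y by apply: contraTneq zy => ->; rewrite ltnn.
  have := dnU eps0 un zy'; rewrite (negPf zd) /= => /Hu.
  by move: zy; clear => /=; lia.
by apply: leq_trans (card_pos_interval _ _) _; clear; lia.
Qed.

(** The error [k] accounts for elements of [dn y1] that come after [y1]. *)
Lemma steady_between_le X y1 y k : cut R r y g -> steady R r y1 k g ->
  (#|between X g y1 y| <= #|X :&: (dn R r y :\: dn R r y1)| + k)%N.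
Proof.
move=> gc /steadyP[Hd _].
rewrite -(cardsID (dn R r y1)) addnC; apply: leq_add.
  apply: subset_leq_card; apply/subsetP => z /setDP[/setIdP[zX /andP[_ zy]] zn].
  have zy' : z != y by apply: contraTneq zy => ->; rewrite ltnn.
  have zd : z \in dn R r y.
    have := dnU eps0 un zy'; case/orP => // zu; have /cutP[_ /(_ z zu)] := gc.
    by move=> h; have := ltn_trans h zy; rewrite ltnn.
  by apply/setIP; split=> //; apply/setDP.
apply: (@leq_trans #|[set z | ((g y1).+1 <= g z < g y1 + k)%N]|).
  apply: subset_leq_card; apply/subsetP => z /setIP[/setIdP[zX /andP[z1 _]] zd].
  by rewrite in_set z1 Hd.
by apply: leq_trans (card_pos_interval _ _) _; clear; lia.
Qed.

(** The error [k] accounts for elements of [dn y2] that come after [y2]. *)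
Lemma steady_between_ge (X : {set T}) y y2 k : y \notin X -> y2 \notin X ->
  cut R r y g -> steady R r y2 k g ->
  (#|X :&: (dn R r y2 :\: dn R r y)| <= #|between X g y y2| + k)%N.
Proof.
move=> yX y2X gc /steadyP[Hd _].
rewrite -(cardsID (between X g y y2)); apply: leq_add.
  by apply: subset_leq_card; apply: subsetIr.
apply: (@leq_trans #|[set z | ((g y2).+1 <= g z < g y2 + k)%N]|).
  apply: subset_leq_card; apply/subsetP => z /setDP[/setIP[zX /setDP[z2 zy]] zb].
  rewrite in_set (Hd _ z2) andbT ltnNge; apply: contra zb => h.
  have zy' : z != y by apply: contraTneq zX => ->.
  have zy2 : z != y2 by apply: contraTneq zX => ->.
  apply/setIdP; split=> //; apply/andP; split.
    by have := dnU eps0 un zy'; rewrite (negPf zy) /=; have /cutP[_] := gc; apply.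
  by rewrite ltn_neqAle h andbT; apply: contraNneq zy2 => /val_inj/gi ->.
by apply: leq_trans (card_pos_interval _ _) _; clear; lia.
Qed.

End SteadyCounts.

(** All four quantities are at least [16 * S * kap], so adding or subtracting [kap] is a relative
    change of at most [x = 1 / (16 * S)]. The factor [1 - 1 / (2 * S)] absorbs these four changes
    and the slack [1 + 1 / (8 * S)] of the hypothesis. *)
Lemma ratio_bound (R : realType) (S kap aL aR lL lR : R) :
  1 <= S -> 0 <= kap -> 16 * S * kap <= aL -> 16 * S * kap <= aR -> aL <= lL -> aR <= lR ->
  8 * S * (lR * aL) <= (8 * S + 1) * (lL * aR) ->
  (1 - (2 * S)^-1) * ((aL + kap) * (lR + kap)) <= (lL - kap) * (aR - kap).
Proof.
move=> S1 k0 haL haR hlL hlR H.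
pose h := S^-1; have S0 : 0 < S by lra.
have hS : h * S = 1 by rewrite /h mulVf ?gt_eqF.
have h0 : 0 < h by rewrite invr_gt0.
have h1 : h <= 1 by rewrite invf_le1.
have -> : (2 * S)^-1 = h / 2 by rewrite invfM mulrC.
pose x := h / 16.
have kx a : 16 * S * kap <= a -> kap <= x * a.
  move=> ha; have := ler_wpM2l (ltW h0) ha.
  have -> : h * (16 * S * kap) = 16 * kap by rewrite -[RHS]mulr1 -hS; ring.
  rewrite /x; lra.
have kaL := kx _ haL; have kaR := kx _ haR.
have klL := kx _ (le_trans haL hlL); have klR := kx _ (le_trans haR hlR).
have p0 : 0 <= 16 * S * kap by rewrite !mulr_ge0 //; lra.
have aL0 := le_trans p0 haL; have aR0 := le_trans p0 haR.
have lL0 := le_trans aL0 hlL; have lR0 := le_trans aR0 hlR.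
have x0 : 0 <= x by rewrite /x; lra.
have x1 : x <= 1 / 16 by rewrite /x; lra.
have up : (aL + kap) * (lR + kap) <= (1 + x) ^+ 2 * (lR * aL).
  have -> : (1 + x) ^+ 2 * (lR * aL) = ((1 + x) * aL) * ((1 + x) * lR) by ring.
  by apply: ler_pM; lra.
have dn : (1 - x) ^+ 2 * (lL * aR) <= (lL - kap) * (aR - kap).
  have -> : (1 - x) ^+ 2 * (lL * aR) = ((1 - x) * lL) * ((1 - x) * aR) by ring.
  by apply: ler_pM; rewrite ?mulr_ge0 //; lra.
have H' : lR * aL <= (1 + h / 8) * (lL * aR).
  have := ler_wpM2l (ltW h0) H.
  have -> : h * (8 * S * (lR * aL)) = 8 * (lR * aL) by rewrite -[RHS]mulr1 -hS; ring.
  have -> : h * ((8 * S + 1) * (lL * aR)) = (8 + h) * (lL * aR).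
    transitivity ((8 * (h * S) + h) * (lL * aR)); first by ring.
    by rewrite hS mulr1.
  move=> h3; lra.
have q0 : 0 <= lL * aR by rewrite mulr_ge0.
apply: le_trans dn.
have f0 : 0 <= 1 - h / 2 by lra.
apply: le_trans (ler_wpM2l f0 up) _.
have f1 : 0 <= (1 - h / 2) * (1 + x) ^+ 2 by rewrite mulr_ge0 ?sqr_ge0.
rewrite mulrA; apply: le_trans (ler_wpM2l f1 H') _.
rewrite mulrA; apply: ler_wpM2r => //.
rewrite /x; nra.
Qed.

(** The conclusion says that [lR / aR] exceeds [lL / aL] by more than the factor [1 + 1 / (8 * S)].
    Otherwise each move of an element of [X] across [y] loses at most the factor [1 - 1 / (2 * S)]
    in probability, and [y] takes [S.+1] consecutive positions with probability at least [cc / 4]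
    each. *)
Lemma slope_growth (R : realType) (eps : R) (w : nat) :
  0 < eps -> eps <= 1 / 2 ->
  exists Lam S : nat, (0 < S)%N /\ forall (T : finType) (r : rel T), unbalanced eps w r ->
    forall (X : {set T}) (y1 y y2 : T),
      (forall z x, x \in X -> r z x -> z \in X) ->
      y1 \notin X -> y \notin X -> y2 \notin X -> r y1 y -> r y y2 ->
      forall aL aR lL lR,
        aL = #|X :&: (dn R r y :\: dn R r y1)| -> aR = #|X :&: (dn R r y2 :\: dn R r y)| ->
        lL = #|dn R r y :\: dn R r y1| -> lR = #|dn R r y2 :\: dn R r y| ->
        (Lam <= aL)%N -> (Lam <= aR)%N ->
        ((8 * S + 1) * (lL * aR) < 8 * S * (lR * aL))%N.
Proof.
move=> eps0 eps1; have c0 := cut_const_gt0 w eps0; set cc := cut_const eps w in c0.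
have dl0 : 0 < cc / 4 by rewrite divr_gt0.
have [k Hk] := steady_prob w eps0 eps1 dl0.
(* [S] makes [S.+1] disjoint events of probability [cc / 4] impossible; [kap] covers the steadiness
   error and the drift of the counts over up to [S] moves. *)
pose S := (Num.bound (4 / cc)).+1; pose kap := (k + S + 1)%N.
exists (16 * S * kap)%N, S; split=> // T r un X y1 y y2 Xdown X1 X0 X2 r1 r2 aL aR lL lR EaL EaR ElL ElR LaL LaR.
rewrite ltnNge; apply/negP => H.
have le0 := un_le0 un.
set t := #|dn R r y|; set t1 := #|dn R r y1|; set t2 := #|dn R r y2|.
have sub12 : dn R r y1 \subset dn R r y.
  by apply/subsetP => z; rewrite !dn_up; apply: (up_up eps0 un r1).
have sub02 : dn R r y \subset dn R r y2.
  by apply/subsetP => z; rewrite !dn_up; apply: (up_up eps0 un r2).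
have et : t = (t1 + lL)%N by rewrite ElL /t -(cardsID (dn R r y1)) (setIidPr sub12).
have et2 : t2 = (t + lR)%N by rewrite ElR /t2 -(cardsID (dn R r y)) (setIidPr sub02).
have alL : (aL <= lL)%N by rewrite EaL ElL; apply: subset_leq_card; apply: subsetIr.
have alR : (aR <= lR)%N by rewrite EaR ElR; apply: subset_leq_card; apply: subsetIr.
pose W s := window r X y1 y y2 (t + s) (t1 + k) (t2 + k) (aL + k + s) (aR - k - s).
pose q s : R := #|W s|%:R / #|le_set r|%:R.
have e0R : 0 < #|le_set r|%:R :> R by rewrite ltr0n.
have q0 : cc / 2 <= q 0%N.
  pose E (g : {ffun T -> 'I_#|T|}) :=
    (cut R r y g && ~~ ~~ steady R r y1 k g) && ~~ ~~ steady R r y2 k g.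
  have PE : cc / 2 <= pr R r E.
    have h1 := cut_prob eps0 un eps1 y; rewrite -/cc in h1.
    have h2 := prD_ge R le0 (cut R r y) (fun g => ~~ steady R r y1 k g).
    have h3 := prD_ge R le0 (fun g => cut R r y g && ~~ ~~ steady R r y1 k g)
                 (fun g => ~~ steady R r y2 k g).
    have h4 := Hk T r un y1; have h5 := Hk T r un y2.
    apply: le_trans h3; move: h1 h2 h4 h5 dl0; clear.
    move: (pr R r _) (pr R r _) (pr R r _) (pr R r _) => p1 p2 p3 p4; lra.
  apply: le_trans PE _; rewrite /pr /q ler_wpM2r ?invr_ge0 ?ler0n // ler_nat.
  apply: subset_leq_card; apply/subsetP => g /setIdP[gL]; rewrite /E !negbK => /andP[/andP[gc g1] g2].
  apply/setIdP; split=> //; rewrite !addn0 subn0; apply/and5P; split.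
  - by apply/eqP; apply: (cut_pos eps0 un gL gc).
  - exact: (steady_pos eps0 un gL g1).
  - exact: (steady_pos eps0 un gL g2).
  - by rewrite EaL; apply: (steady_between_le eps0 un gL).
  by rewrite leq_subLR addnC EaR; apply: (steady_between_ge eps0 un gL).
have step s : (s < S)%N -> (1 - (2 * S%:R)^-1) * q s <= q s.+1.
  move=> sS.
  have := @window_transition T r X y1 y y2 Xdown X1 X0 X2 r1 r2 (t + s) (t1 + k) (t2 + k)
            (aL + k + s) (aR - k - s).
  rewrite -/(W s) (_ : window _ _ _ _ _ _ _ _ _ _ = W s.+1); last first.
    by rewrite /W; congr (window _ _ _ _ _ _ _ _ _ _); clear; lia.
  have hl : (lL - kap <= t + s - (t1 + k))%N by rewrite et /kap; clear; lia.
  have ha : (aR - kap <= aR - k - s)%N by rewrite /kap; move: sS; clear; lia.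
  have hb : ((aL + k + s).+1 <= aL + kap)%N by rewrite /kap; move: sS; clear; lia.
  have hr : (t2 + k - (t + s).+1 <= lR + kap)%N by rewrite et2 /kap; clear; lia.
  move=> tr.
  have {tr} : (#|W s| * ((lL - kap) * (aR - kap)) <= #|W s.+1| * ((aL + kap) * (lR + kap)))%N.
    apply: leq_trans (_ : #|W s| * ((t + s - (t1 + k)) * (aR - k - s)) <= _)%N.
      by rewrite leq_mul2l leq_mul ?orbT.
    by apply: leq_trans tr _; rewrite leq_mul2l leq_mul ?orbT.
  rewrite -(ler_nat R) !natrM => tr.
  have kS : (kap <= 16 * S * kap)%N by rewrite leq_pmull // muln_gt0.
  have kaR : (kap <= aR)%N := leq_trans kS LaR.
  have klL : (kap <= lL)%N := leq_trans (leq_trans kS LaL) alL.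
  rewrite (natrB _ klL) (natrB _ kaR) (natrD _ aL kap) (natrD _ lR kap) in tr.
  have rb : (1 - (2 * S%:R)^-1) * ((aL%:R + kap%:R) * (lR%:R + kap%:R)) <=
      (lL%:R - kap%:R) * (aR%:R - kap%:R) :> R.
    apply: (@ratio_bound _ S%:R); rewrite ?ler1n ?ler0n ?ler_nat // -?natrM ?ler_nat //.
    by move: H; rewrite -(ler_nat R) (natrM _ (8 * S + 1)) natrD natrM.
  have D0 : 0 < (aL%:R + kap%:R) * (lR%:R + kap%:R) :> R.
    by rewrite mulr_gt0 // -natrD ltr0n /kap; clear; lia.
  rewrite /q mulrA ler_pM2r ?invr_gt0 // -(ler_pM2r D0).
  apply: le_trans tr; rewrite mulrAC mulrC.
  by apply: ler_wpM2l; rewrite ?ler0n.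
have S0 : 0 < S%:R :> R by rewrite ltr0n.
(* Bernoulli's inequality for the power [s] of [1 - 1 / (2 * S)]; for [s <= S] at least half of the
   initial [cc / 2] is left. *)
have low s : (s <= S)%N -> (1 - s%:R / (2 * S%:R)) * (cc / 2) <= q s.
  elim: s => [|s IH] sS; first by rewrite mul0r subr0 mul1r.
  apply: le_trans (step s sS).
  have f0 : 0 <= 1 - (2 * S%:R)^-1 :> R.
    rewrite subr_ge0 invf_le1 ?mulr_gt0 //.
    by have : 1 <= S%:R :> R by [rewrite ler1n]; lra.
  apply: le_trans (ler_wpM2l f0 (IH (ltnW sS))).
  rewrite [leRHS]mulrA; apply: ler_wpM2r; first by rewrite divr_ge0 // ltW.
  rewrite -natr1; set v := (2 * S%:R)^-1.
  have v0 : 0 <= v by rewrite invr_ge0 mulr_ge0 ?ler0n.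
  have sv : 0 <= s%:R * v * v by rewrite !mulr_ge0 ?ler0n.
  lra.
have quarter s : (s <= S)%N -> cc / 4 <= q s.
  move=> sS; apply: le_trans (low s sS).
  have : s%:R / (2 * S%:R) <= 1 / 2 :> R.
    rewrite ler_pdivrMr ?mulr_gt0 //; have : s%:R <= S%:R :> R by rewrite ler_nat.
    lra.
  move: (s%:R / (2 * S%:R)) => v hv; nra.
have := @pr_disjoint_sum R T r S (fun s g => g y == (t + s)%N :> nat) (cc / 4).
move=> Hd; have {Hd} : S.+1%:R * (cc / 4) <= 1.
  apply: Hd.
    by move=> s s' g ss /eqP -> /eqP; move: ss; clear; lia.
  move=> s sS; apply: le_trans (quarter s sS) _.
  rewrite /pr /q ler_wpM2r ?invr_ge0 ?ler0n // ler_nat; apply: subset_leq_card.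
  by apply/subsetP => g /setIdP[gL /and5P[gy _ _ _ _]]; apply/setIdP.
have Sb : 4 / cc < S.+1%:R.
  have : 4 / cc < (Num.bound (4 / cc))%:R by apply: archi_boundP; rewrite divr_ge0 // ltW.
  by move/lt_le_trans; apply; rewrite ler_nat /S; clear; lia.
move: Sb; rewrite ltr_pdivrMr // => Sb h.
by move: h; rewrite mulrA ler_pdivrMr // mul1r leNgt Sb.
Qed.

(** * Long chains of incomparable elements *)

Local Open Scope nat_scope.

Section Converse.
Local Open Scope ring_scope.
Variables (R : realType) (T : finType) (r : rel T).

Let conv : rel T := fun a b => r b a.
Let flip (g : {ffun T -> 'I_#|T|}) : {ffun T -> 'I_#|T|} := [ffun z => rev_ord (g z)].

Lemma flipK : involutive flip.
Proof. by move=> g; apply/ffunP => z; rewrite !ffunE rev_ordK. Qed.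

Lemma flip_lt g x y : (flip g x < flip g y)%N = (g y < g x)%N.
Proof.
by rewrite !ffunE /=; have := ltn_ord (g x); have := ltn_ord (g y); clear => /=; lia.
Qed.

Lemma flip_conv g : (flip g \in le_set conv) = (g \in le_set r).
Proof.
apply/le_setP/le_setP => -[go gi]; split.
- by move=> a b ab; rewrite -flip_lt; apply: go.
- by move=> a b ab; apply: gi; rewrite !ffunE ab.
- by move=> a b ab; rewrite flip_lt; apply: go.
by move=> a b; rewrite !ffunE => /rev_ord_inj /gi.
Qed.

Lemma plt_conv x y : plt R conv x y = plt R r y x.
Proof.
have cnt (P : pred {ffun T -> 'I_#|T|}) :
    #|[set g in le_set conv | P g]| = #|[set g in le_set r | P (flip g)]|.
  rewrite -(card_imset _ (can_inj flipK)); congr #|pred_of_set _|.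
  apply/setP => g; apply/imsetP/idP.
    by case=> h /setIdP[hL Ph] ->; apply/setIdP; rewrite -flip_conv flipK.
  move=> /setIdP[gL Pg]; exists (flip g); last by rewrite flipK.
  by apply/setIdP; rewrite flip_conv.
have tot : #|le_set conv| = #|le_set r|.
  have := cnt predT; rewrite (_ : [set g in le_set conv | _] = le_set conv); last first.
    by apply/setP => g; rewrite inE andbT.
  by rewrite (_ : [set g in le_set r | _] = le_set r) //; apply/setP => g; rewrite inE andbT.
rewrite /plt /pr tot cnt; congr (_%:R / _); apply: eq_card => g.
by rewrite !inE flip_lt.
Qed.

Lemma unbalanced_conv (eps : R) w : unbalanced eps w r -> unbalanced eps w conv.
Proof.
case=> ir tr u a; split=> //.
- by move=> x y z yx zy; apply: tr zy yx.
- by move=> x y xy; rewrite plt_conv; apply: u; rewrite eq_sym.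
by move=> A hA; apply: a => x y xA yA; apply: hA.
Qed.

End Converse.

(** Remove the at most [w] maximal elements of [A]; a chain found in the rest ends in a non-maximal
    element and can be prolonged. *)
Lemma long_chain (T : finType) (r : rel T) (w k : nat) (A : {set T}) :
  irreflexive r -> transitive r ->
  (forall B : {set T}, (forall x y, x \in B -> y \in B -> ~~ r x y) -> #|B| <= w) ->
  w * k < #|A| ->
  exists c : nat -> T, (forall i, i <= k -> c i \in A) /\
    forall i j, i < j <= k -> r (c i) (c j).
Proof.
move=> ir tr hw; elim: k A => [|k IH] A cA.
  have /card_gt0P[z zA] : 0 < #|A| by rewrite (leq_ltn_trans _ cA).
  by exists (fun=> z); split=> // i [|j] /andP[].
pose M := [set z in A | [forall y in A, ~~ r z y]].
have cM : #|M| <= w.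
  by apply: hw => x y /setIdP[_ /forall_inP h] /setIdP[yA _]; apply: h.
have cD : w * k < #|A :\: M|.
  have := cardsID M A; have := subset_leq_card (subsetIr A M).
  by move: cM cA; clear; lia.
have [c [cin cc]] := IH _ cD.
have /setDP[kA] := cin k (leqnn k).
rewrite inE kA /= negb_forall => /existsP[z]; rewrite negb_imply negbK => /andP[zA kz].
exists (fun i => if i <= k then c i else z); split.
  by move=> i _; case: ifP => // /cin /setDP[].
move=> i j /andP[ij jk]; case: (leqP j k) => hj.
  by rewrite (leq_trans (ltnW ij) hj); apply: cc; rewrite ij.
have ik : i <= k by rewrite -ltnS (leq_trans ij).
rewrite ik; move: ik; rewrite leq_eqVlt => /orP[/eqP-> //|ik].
by apply: tr kz; apply: cc; rewrite ik /=.
Qed.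

Definition incomp (T : finType) (r : rel T) (x : T) : {set T} :=
  [set y | [&& y != x, ~~ r y x & ~~ r x y]].

Section ChainBound.
Variables (R : realType) (eps : R) (w : nat).
Hypotheses (eps0 : (0 < eps)%R) (eps1 : (eps <= 1 / 2)%R).
Variables (T : finType) (r : rel T).
Hypothesis un : unbalanced eps w r.

(** Let [z] be in the difference, so that it is neither below [y] nor above [y']. If [z] is below
    [x], it is incomparable to [y]; if above [x], incomparable to [y']; otherwise it is [x] or
    incomparable to [x]. *)
Lemma dn_gap_card x y y' q :
  y \in incomp r x -> y' \in incomp r x -> y' \in dn R r x ->
  (forall z, #|incomp r z| <= q) -> #|dn R r y' :\: dn R r y| <= 3 * q + 1.
Proof.
move=> yx y'x dx hq.
have sub : dn R r y' :\: dn R r y \subset (incomp r x :|: incomp r y) :|: (incomp r y' :|: [set x]).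
  apply/subsetP => z /setDP[zy' zy].
  have nzy : ~~ r z y by apply: contra zy => /(rel_dn eps0 un).
  have ny'z : ~~ r y' z.
    by apply: contraL zy' => h; apply: contraL (rel_up eps0 un h) => /(dn_not_up eps0 un).
  move: yx y'x; rewrite !inE => /and3P[_ yx xy] /and3P[_ y'x xy'].
  have nxy' : ~~ r x y' by [].
  case: (eqVneq z x) => //= [|zx]; first by rewrite !orbT.
  case zlx: (r z x).
    have -> : z != y by apply: contraNneq yx => <-.
    rewrite nzy /=; case yz: (r y z); last by [].
    by rewrite (un_tr un yz zlx) in yx.
  case xlz: (r x z) => //=.
  have -> : z != y' by apply: contraNneq xy' => <-.
  rewrite ny'z andbT /=; case zy'r: (r z y') => /=; last by rewrite !orbT.
  by rewrite (un_tr un xlz zy'r) in xy'.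
apply: leq_trans (subset_leq_card sub) _.
apply: leq_trans (leq_card_setU _ _) _; have := leq_card_setU (incomp r x) (incomp r y) => -[+ _].
have := leq_card_setU (incomp r y') [set x]; rewrite cards1 => -[+ _].
have := hq x; have := hq y; have := hq y'; clear; lia.
Qed.

End ChainBound.

(** Cut the chain into [M.+1] blocks of length [J]. The ratios [l i / a i] start at 1 or more and
    grow geometrically by [slope_growth], while [l M <= 3 * q + 1]. *)
Lemma chain_growth (R : realType) (eps : R) (w : nat) :
  (0 < eps)%R -> (eps <= 1 / 2)%R ->
  exists J S : nat, [/\ 0 < J, 0 < S & forall (T : finType) (r : rel T), unbalanced eps w r ->
    forall x q (c : nat -> T) M, (forall z, #|incomp r z| <= q) ->
      (forall i, i <= J * M.+1 -> c i \in incomp r x :&: dn R r x) ->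
      (forall i j, i < j <= J * M.+1 -> r (c i) (c j)) ->
      (S + 1) ^ M <= S ^ M * (3 * q + 1)].
Proof.
move=> eps0 eps1; have [Lam [S [S0 HS]]] := slope_growth w eps0 eps1.
have [s0 Hs0] := below_density w eps0 eps1.
(* Each stretch of [s0.+1] chain elements adds an element of [X], so a block has more than [Lam] of
   them. The returned constant is [8 * S], to match the growth factor. *)
pose J := Lam.+1 * s0.+1; exists J, (8 * S); split; rewrite ?muln_gt0 //.
move=> T r un x q c M hq cin cc.
have cdn i : i <= J * M.+1 -> c i \in dn R r x by move/cin/setIP => [].
have cnr i : i <= J * M.+1 -> ~~ r (c i) x.
  by move/cin/setIP => [+ _]; rewrite inE => /and3P[].
pose X := [set z | (z == x) || r z x].
have Xdown z u : u \in X -> r z u -> z \in X.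
  rewrite !inE => /orP[/eqP-> ->|ux zu]; first by rewrite orbT.
  by rewrite (un_tr un zu ux) orbT.
have cX i : i <= J * M.+1 -> c i \notin X.
  move=> iM; rewrite inE negb_or cnr // andbT.
  by move/cin: iM; rewrite !inE => /andP[/and3P[]].
have dnS i j : i <= j -> j <= J * M.+1 -> dn R r (c i) \subset dn R r (c j).
  rewrite leq_eqVlt => /orP[/eqP-> //|ij] jM; apply/subsetP => z.
  have /cc cij : i < j <= J * M.+1 by rewrite ij.
  by rewrite !dn_up; apply: (up_up eps0 un cij).
have dens k i : i + k * s0.+1 <= J * M.+1 ->
    k <= #|X :&: (dn R r (c (i + k * s0.+1)) :\: dn R r (c i))|.
  elim: k => // k IH; rewrite mulSn addnCA addnC => hk.
  have h1 : i + k * s0.+1 + s0 <= J * M.+1 by move: hk; clear; lia.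
  have [a [ax ain aout]] := Hs0 T r un x c (J * M.+1) cc cdn cnr _ h1.
  have {}IH := IH (leq_trans (leq_addr _ _) h1).
  apply: leq_ltn_trans IH _; apply: proper_card; apply/properP; split.
    by apply: setIS; apply: setSD; apply: dnS => //; apply: leq_addr.
  exists a; last by rewrite in_setI in_setD (negbTE aout) !andbF.
  have ain' : a \in dn R r (c (i + k * s0.+1 + s0.+1)).
    by apply: subsetP (dnS _ _ _ hk) _ ain; rewrite addnS.
  rewrite in_setI in_setD ain' andbT inE ax /=; apply: contra aout.
  by apply: subsetP (dnS _ _ (leq_addr _ _) _) _; rewrite (leq_trans _ h1) ?leq_addr.
pose y i := c (J * i).
pose a i := #|X :&: (dn R r (y i.+1) :\: dn R r (y i))|.
pose l i := #|dn R r (y i.+1) :\: dn R r (y i)|.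
have aL i : i <= M -> Lam < a i.
  move=> iM; have := dens Lam.+1 (J * i); rewrite -/J addnC -mulnS; apply.
  by rewrite leq_mul2l ltnS iM orbT.
have al i : a i <= l i by apply: subset_leq_card; apply: subsetIr.
have yM i : i <= M.+1 -> J * i <= J * M.+1 by move=> h; rewrite leq_mul2l h orbT.
have yy i : i <= M -> r (y i) (y i.+1).
  by move=> iM; apply: cc; rewrite yM // ltn_pmul2l ?leqnn.
have grow i : i <= M -> (8 * S + 1) ^ i * a i <= (8 * S) ^ i * l i.
  elim: i => [|i IH] iM; first by rewrite !expn0 !mul1n.
  have {IH} ih := IH (ltnW iM).
  have sg : (8 * S + 1) * (l i * a i.+1) < 8 * S * (l i.+1 * a i).
    have Xy j : j <= M.+1 -> y j \notin X by move/yM/cX.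
    have i1 := Xy i (leqW (ltnW iM)); have i2 := Xy i.+1 (leqW iM); have i3 := Xy i.+2 iM.
    exact: (HS T r un X _ _ _ Xdown i1 i2 i3 (yy i (ltnW iM)) (yy i.+1 iM) _ _ _ _
              erefl erefl erefl erefl (ltnW (aL i (ltnW iM))) (ltnW (aL i.+1 iM))).
  have l0 : 0 < l i by apply: leq_trans (al i); apply: leq_ltn_trans (aL i (ltnW iM)).
  rewrite -(leq_pmul2l l0) !expnS; move: ih (ltnW sg); clear.
  move: (l i) (l i.+1) (a i) (a i.+1) (8 * S + 1) => l1 l2 a1 a2 A; move: (8 * S) => B.
  move: (A ^ i) (B ^ i) => Ai Bi ih sg.
  apply: leq_trans (_ : Ai * (B * (l2 * a1)) <= _).
    by rewrite (_ : l1 * (A * Ai * a2) = Ai * (A * (l1 * a2))) ?leq_mul2l ?sg ?orbT //; ring.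
  rewrite (_ : Ai * _ = (Ai * a1) * (B * l2)); last by ring.
  by rewrite (_ : l1 * (B * Bi * l2) = (Bi * l1) * (B * l2)) ?leq_mul2r ?ih ?orbT //; ring.
have aM := aL M (leqnn M); have := grow M (leqnn M).
have lq : l M <= 3 * q + 1.
  have /setIP[c1 _] := cin _ (yM M (leqnSn M)); have /setIP[c2 c3] := cin _ (leqnn (J * M.+1)).
  exact: (dn_gap_card eps0 un c1 c2 c3 hq).
move=> h; apply: leq_trans (_ : (8 * S + 1) ^ M * a M <= _).
  by rewrite leq_pmulr // (leq_ltn_trans _ aM).
by apply: leq_trans h _; rewrite leq_mul2l lq orbT.
Qed.

(** Bernoulli's inequality for exponent [k], squared, gives growth quadratic in [k], which beats the
    linear factor. *)
Lemma linear_lt_expn (s b : nat) : 0 < s ->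
  exists k0, forall k, k0 <= k -> s ^ k.*2 * (b * k.+1) < (s + 1) ^ k.*2.
Proof.
move=> s0.
have bern k : s ^ k * (s + k) <= s * (s + 1) ^ k.
  elim: k => [|k IH]; first by rewrite !expn0 !muln1 mul1n addn0.
  rewrite !expnS; move: (s ^ k) ((s + 1) ^ k) IH => A B IH.
  have : s * (A * (s + k)) <= s * (s * B) by rewrite leq_mul2l IH orbT.
  nia.
exists (s ^ 2 * (2 * b)).+1 => k hk.
have sk0 : 0 < s ^ k by rewrite expn_gt0 s0.
have sq : s ^ 2 * (b * k.+1) < (s + k) ^ 2.
  move: hk; rewrite !expnS !expn0 !muln1; nia.
rewrite -mul2n [2 * k]mulnC !expnM -(@ltn_pmul2l (s ^ 2)) ?expn_gt0 ?s0 // -expnMn.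
apply: leq_trans (_ : ((s ^ k * (s + k)) ^ 2) <= _).
  by rewrite (expnMn (s ^ k)) mulnCA ltn_pmul2l // expn_gt0 sk0.
by rewrite leq_exp2r.
Qed.

(** Take [x] with the most incomparable elements, [q] in number. By [long_chain] and [chain_growth]
    the part in [dn x], and dually the part in [up x], is too small for the two to add up to [q]
    when [q] is large. *)
Lemma incomp_bounded (R : realType) (eps : R) (w : nat) :
  (0 < eps)%R -> (eps <= 1 / 2)%R ->
  exists p, forall (T : finType) (r : rel T), unbalanced eps w r ->
    forall x, #|incomp r x| <= p.
Proof.
move=> eps0 eps1; have [J [S [J0 S0 H]]] := chain_growth w eps0 eps1.
pose G := 2 * w.+1 * J.
(* With [q <= G * (2 * k + 3)] below, [3 * q + 1 <= 15 * G * k.+1]; the exponent [k.*2] is the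
   number [M] of blocks used. *)
have [k0 Hk0] := linear_lt_expn (15 * G) S0.
exists (G * (2 * k0 + 1)) => T r un x0; rewrite leqNgt; apply/negP => hx0.
pose x := [arg max_(z > x0 | true) #|incomp r z|].
have xmax z : #|incomp r z| <= #|incomp r x|.
  by rewrite /x; case: arg_maxnP => // i _; apply.
have {hx0} hx := leq_trans hx0 (xmax x0).
have G0 : 0 < G by rewrite !muln_gt0.
have [k [k0k lo hi]] : exists k, [/\ k0 <= k, G * (2 * k + 1) < #|incomp r x| &
    #|incomp r x| <= G * (2 * k + 3)].
  move: #|incomp r x| hx => q hq; exists ((q - G - 1) %/ (2 * G)).
  have d0 : 0 < 2 * G by rewrite muln_gt0.
  have e := divn_eq (q - G - 1) (2 * G); have l := ltn_pmod (q - G - 1) d0.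
  split.
  - by rewrite leq_divRL //; move: hq; clear; nia.
  - by move: e l hq; clear; set k := _ %/ _; set m := _ %% _; clearbody k m; nia.
  by move: e l hq; clear; set k := _ %/ _; set m := _ %% _; clearbody k m; nia.
have half (r' : rel T) : unbalanced eps w r' -> (forall z, #|incomp r' z| = #|incomp r z|) ->
    #|incomp r' x :&: dn R r' x| <= w * (J * (2 * k).+1).
  move=> un' sz; rewrite leqNgt; apply/negP => big; have [ir tr _ wd] := un'.
  have [c [cin cc]] := long_chain ir tr wd big.
  have hq z : #|incomp r' z| <= #|incomp r x| by rewrite sz.
  have := H T r' un' x _ c _ hq cin cc; rewrite leqNgt => /negP; apply.
  have := Hk0 k k0k; rewrite -mul2n; apply: leq_ltn_trans.
  rewrite leq_mul2l; apply/orP; right.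
  by move: hi G0; clear; nia.
have dual : #|incomp r x :&: up R r x| <= w * (J * (2 * k).+1).
  pose conv : rel T := fun a b => r b a.
  have ec z : incomp conv z = incomp r z.
    by apply/setP => u; rewrite !inE /conv; congr (_ && _); rewrite andbC.
  have := half conv (unbalanced_conv un) (fun z => congr1 (fun A : {set T} => #|A|) (ec z)).
  rewrite ec.
  rewrite (_ : dn R conv x = up R r x) //; apply/setP => z.
  by rewrite !inE plt_conv.
have cover : incomp r x \subset (incomp r x :&: dn R r x) :|: (incomp r x :&: up R r x).
  apply/subsetP => z zx; rewrite -setIUr in_setI zx in_setU.
  by apply: (dnU eps0 un); move: zx; rewrite inE => /and3P[].
have := half r un (fun=> erefl).
have [+ _] := leq_card_setU (incomp r x :&: dn R r x) (incomp r x :&: up R r x).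
move: (subset_leq_card cover) dual lo J0; rewrite /G; clear.
move: #|incomp r x :&: dn R r x| #|incomp r x :&: up R r x| #|incomp r x| #|_ :|: _|.
move=> a b q u; nia.
Qed.

(** * Linear extensions as sets of pairs *)

Section Bridge.
Local Open Scope ring_scope.
Variables (R : realType) (d : Order.disp_t) (P : finPOrderType d).

Definition strict : rel P := fun x y => (x < y)%O.

Lemma strict_irr : irreflexive strict.
Proof. by move=> x; apply: ltxx. Qed.

Lemma strict_tr : transitive strict.
Proof. by move=> y x z; apply: lt_trans. Qed.

Definition graph_of (g : {ffun P -> 'I_#|P|}) : {set P * P} := [set p | (g p.1 < g p.2)%N].

Lemma graph_ofE g x y : ((x, y) \in graph_of g) = (g x < g y)%N.
Proof. by rewrite inE. Qed.

(** The position of an element is the number of its predecessors, which the graph determines. *)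
Lemma graph_of_inj : {in le_set strict &, injective graph_of}.
Proof.
have pos (g : {ffun P -> 'I_#|P|}) z : injective g -> nat_of_ord (g z) = #|[set e | (g e < g z)%N]|.
  move=> gi; rewrite (card_positions (fun q => q < g z)%N gi).
  by rewrite (card_ord_interval 0 (ltnW (ltn_ord (g z)))) subn0.
move=> g h /le_setP[_ gi] /le_setP[_ hi] E; apply/ffunP => z; apply: val_inj.
rewrite /= (pos g z gi) (pos h z hi); apply: eq_card => e.
by rewrite !inE -!graph_ofE E.
Qed.

(** Conversely, a strict linear order yields positions by counting predecessors. *)
Lemma linear_extensionsE : linear_extensions P = graph_of @: le_set strict.
Proof.
apply/setP => L; rewrite inE; apply/idP/imsetP.
  move=> /andP[/and3P[/forallP ir /forallP tr /forallP tot] /forallP ext].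
  have Ltr x y z : (x, y) \in L -> (y, z) \in L -> (x, z) \in L.
    by move=> xy yz; have /forallP/(_ y)/forallP/(_ z) := tr x; rewrite xy yz.
  have bd z : (#|[set e | (e, z) \in L]| < #|P|)%N.
    apply: (@leq_trans #|[set: P]|); last by rewrite cardsT.
    by apply: proper_card; apply/properP; split; [apply: subsetT | exists z; rewrite ?inE ?ir].
  pose g : {ffun P -> 'I_#|P|} := [ffun z => Ordinal (bd z)].
  have lt x y : (x, y) \in L -> (g x < g y)%N.
    move=> xy; rewrite !ffunE /=; apply: proper_card; apply/properP; split.
      by apply/subsetP => e; rewrite !inE => ex; apply: Ltr ex xy.
    by exists x; rewrite inE ?xy ?ir.
  have neq x y : x != y -> ((x, y) \in L) || ((y, x) \in L).
    by move=> xy; have /forallP/(_ y) := tot x; rewrite xy.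
  exists g.
    apply/le_setP; split=> [x y xy|x y xy].
      by apply: lt; have /forallP/(_ y)/implyP := ext x; apply.
    by apply/eqP; apply: contraT => /neq /orP[] /lt; rewrite xy ltnn.
  apply/setP => -[x y]; rewrite graph_ofE; apply/idP/idP => [/lt //|xy].
  have /neq /orP[//|/lt] : x != y by apply: contraTneq xy => ->; rewrite ltnn.
  by move: xy; clear; lia.
case=> g /le_setP[go gi] ->; apply/andP; split; last first.
  by apply/forallP => x; apply/forallP => y; apply/implyP => /go; rewrite graph_ofE.
apply/and3P; split; apply/forallP => x.
- by rewrite graph_ofE ltnn.
- apply/forallP => y; apply/forallP => z; rewrite !graph_ofE.
  by apply/implyP => /andP[]; apply: ltn_trans.
apply/forallP => y; apply/implyP => xy; rewrite !graph_ofE.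
by rewrite -neq_ltn; apply: contra xy => /eqP/val_inj/gi ->.
Qed.

Lemma prec_probE x y : prec_prob R x y = plt R strict x y.
Proof.
rewrite /prec_prob /plt /pr linear_extensionsE card_in_imset; last exact: graph_of_inj.
congr (_%:R / _); rewrite -(card_in_imset (D := [set g in le_set strict | (g x < g y)%N]) (f := graph_of)).
  apply: eq_card => L; rewrite inE; apply/andP/imsetP.
    by case=> /imsetP[g gL ->]; rewrite graph_ofE => xy; exists g => //; apply/setIdP.
  by case=> g /setIdP[gL xy] ->; rewrite graph_ofE imset_f.
by move=> g h /setIdP[gL _] /setIdP[hL _]; apply: graph_of_inj.
Qed.

Lemma antichain_width (A : {set P}) :
  (forall x y, x \in A -> y \in A -> ~~ strict x y) -> (#|A| <= width P)%N.
Proof.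
move=> h; apply: (leq_bigmax_cond (F := fun A : {set P} => #|A|)).
apply/forall_inP => x xA; apply/forall_inP => y yA; apply/implyP => xy.
rewrite /Order.comparable !le_eqVlt (eq_sym y) (negbTE xy) /=.
by apply/norP; split; apply: h.
Qed.

Lemma strict_unbalanced (eps : R) w : delta P R <= 1 / 2 - eps -> (width P <= w)%N ->
  unbalanced eps w strict.
Proof.
move=> dl wd; split; [exact: strict_irr | exact: strict_tr | | ].
  move=> x y xy.
  have : delta_pair R x y <= 1 / 2 - eps.
    apply: le_trans dl.
    by rewrite /delta; apply: (le_bigmax_cond _ (j := (x, y)) (P := fun p => p.1 != p.2)).
  rewrite /delta_pair !prec_probE ge_min => /orP[|]; first by left.
  by rewrite (pr_lt_sym R (le_set_nonempty strict_irr strict_tr) xy) => ?; right; lra.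
by move=> A /antichain_width hA; apply: leq_trans wd.
Qed.

Lemma pi_elt_incomp (x : P) : pi_elt x = #|incomp strict x|.
Proof.
apply: eq_card => y; rewrite !inE /Order.comparable !le_eqVlt (eq_sym x).
by case: (y == x); rewrite //= negb_or.
Qed.

End Bridge.

Local Open Scope ring_scope.

Theorem theorem1p7 (R : realType)
  (hwidth : forall eps : R, 0 < eps ->
     exists w : nat, forall (d : Order.disp_t) (P : finPOrderType d),
       (w < width P)%N -> 1 / 2 - eps < delta P R) :
  forall eps : R, 0 < eps ->
    exists p : nat, forall (d : Order.disp_t) (P : finPOrderType d),
      (p < pi_poset P)%N -> 1 / 2 - eps < delta P R.
Proof.
move=> eps eps0; have [epsle|epsgt] := leP eps (1 / 2); last first.
  (* For [eps > 1 / 2] the bound is negative, whereas [delta] is nonnegative. *)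
  exists 0%N => d P _; apply: lt_le_trans (_ : 0 <= _); first by rewrite subr_lt0.
  rewrite /delta; elim/big_ind: _ => // [a b a0 b0|p _]; first by rewrite le_max a0.
  by rewrite /delta_pair le_min /prec_prob !divr_ge0 ?ler0n.
have [w Hw] := hwidth eps eps0; have [p Hp] := incomp_bounded w eps0 epsle.
exists p => d P hp; rewrite ltNge; apply/negP => hd.
have wP : (width P <= w)%N by rewrite leqNgt; apply/negP => /Hw; rewrite ltNge hd.
have un := strict_unbalanced hd wP.
move: hp; rewrite ltnNge => /negP; apply; apply/bigmax_leqP => x _.
by rewrite pi_elt_incomp; apply: Hp un x.
Qed.
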